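(* Let $W=\mathcal S_n$, $S=\{s_1,\dots,s_{n-1}\}$, $J'_{n-2}=\{s_3,\dots,s_{n-1}\}$, $\mathscr H$ the Hecke algebra of $W$, and $\Gamma$ a $W$-graph. Let $\tilde\beta:\mathscr H\otimes_{J'_{n-2}}A\Gamma\to\mathscr H\otimes_{S\setminus s_2}A\Gamma$, $h\boxtimes e\mapsto h\boxtimes e$, be the natural projection. After adjoining $\frac1{[2]}$ to $A$, there exists a $\bar{\cdot}$-invariant basis $\{c_{x,\gamma}:x\in W^{J'_{n-2}},\gamma\in\Gamma\}$ of $\mathscr H\otimes_{J'_{n-2}}A\Gamma$ such that the transition matrix to the canonical basis $\{\tilde C'_{x,\gamma}:x\in W^{J'_{n-2}},\gamma\in\Gamma\}$ tends to the identity matrix as $u\to0$, and such that under $\tilde\beta$ $$\begin{array}{rcll} c_{ws_1,\gamma}&\longmapsto&[2]\,\tilde C'_{w,\gamma}&\text{if }s_1\in L(\gamma),\\ c_{w,\gamma}&\longmapsto&0&\text{if }s_1\in L(\gamma),\\ c_{ws_1,\gamma}&\longmapsto&0&\text{if }s_1\notin L(\gamma),\\ c_{w,\gamma}&\longmapsto&\tilde C'_{w,\gamma}&\text{if }s_1\notin L(\gamma), \end{array}$$ where $w$ is any element of $W^{S\setminus s_2}$.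
   Context: Let $A=\mathbb Z[u,u^{-1}]$, $A^-=\mathbb Z[u^{-1}]$, $\bar u=u^{-1}$, $[2]=u+u^{-1}$. The Hecke algebra $\mathscr H$ of $(W,S)$ is the free $A$-module on $\{T_w\}$ with $T_vT_w=T_{vw}$ if $\ell(vw)=\ell(v)+\ell(w)$ and $(T_s-u)(T_s+u^{-1})=0$; $\bar{\cdot}$ is the semilinear involution with $\overline{T_w}=T_{w^{-1}}^{-1}$; $C'_s=T_s+u^{-1}$. For $K\subseteq S$, $W_K$ is the parabolic subgroup, $\mathscr H_K$ its Hecke algebra, $W^K$ the minimal length representatives of cosets $wW_K$; $S\setminus s_2$ means $S\setminus\{s_2\}$. One has $W^{J'_{n-2}}=W^{S\setminus s_2}\sqcup W^{S\setminus s_2}s_1$. A $W$-graph is a set $\Gamma$ with weights $\mu(\delta,\gamma)\in\mathbb Z$ and descent sets $L(\gamma)\subseteq S$ such that $A\Gamma$ is a left $\mathscr H$-module via $C'_s\gamma=[2]\gamma$ if $s\in L(\gamma)$ and $C'_s\gamma=\sum_{\delta:s\in L(\delta)}\mu(\delta,\gamma)\delta$ otherwise; $A\Gamma$ carries the semilinear involution $\bar{\cdot}$ fixing $\Gamma$. Restricting to $\mathscr H_K$ gives a $W_K$-graph. Write $\mathscr H\otimes_K E:=\mathscr H\otimes_{\mathscr H_K}E$ with pure tensors $h\boxtimes e$. For a $W_K$-graph $\Gamma$, $\mathscr H\otimes_K A\Gamma$ has involution $\overline{h\boxtimes e}=\bar h\boxtimes\bar e$ and a unique $\bar{\cdot}$-invariant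 basis (the canonical basis) $\tilde C'_{w,\gamma}$ ($w\in W^K$, $\gamma\in\Gamma$) with $\tilde C'_{w,\gamma}\equiv T_w\boxtimes\gamma\bmod u^{-1}A^-\{T_x\boxtimes\delta:x\in W^K,\delta\in\Gamma\}$ (Howlett-Yin). In the displayed formulas, elements $\tilde C'_{w,\gamma}$ on the right are canonical basis elements of $\mathscr H\otimes_{S\setminus s_2}A\Gamma$. After adjoining $1/[2]$, entries of the transition matrix lie in $A[1/[2]]\subset\mathbb Q(u)$. *)

(* Defs.v *)
From HB Require Import structures.
From mathcomp Require Import all_boot all_order all_fingroup all_algebra.
From mathcomp Require Import fraction finmap boolp ring.

Set Implicit Arguments.
Unset Strict Implicit.
Unset Printing Implicit Defensive.

Import GRing.Theory.
Local Open Scope ring_scope.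

(* The fraction field of Z[u], i.e. Q(u). *)
Definition Qu : fieldType := {fraction {poly int}}.
Definition frac_of (p : {poly int}) : Qu := tofrac p.
Definition uQ : Qu := frac_of 'X.
Definition twoQ : Qu := uQ + uQ^-1.

(* Z[u,u^-1] and Z[u,u^-1][1/[2]] as subrings of Q(u). *)
Definition laurent_pred : {pred Qu} :=
  fun f => `[< exists (p : {poly int}) (k : nat), f = frac_of p / uQ ^+ k >].
Definition laurent2_pred : {pred Qu} :=
  fun f => `[< exists2 a : Qu, a \in laurent_pred &
                 exists m : nat, f = a / twoQ ^+ m >].

Lemma uQ_neq0 : uQ != 0.
Proof. by rewrite /uQ /frac_of tofrac_eq0 polyX_eq0. Qed.

Lemma twoQ_u : twoQ * uQ = frac_of ('X ^+ 2 + 1).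
Proof.
rewrite /twoQ mulrDl mulVf ?uQ_neq0 // /uQ /frac_of rmorphD rmorphXn /=.
by rewrite rmorph1 expr2.
Qed.

Lemma twoQ_neq0 : twoQ != 0.
Proof.
have : twoQ * uQ != 0.
  rewrite twoQ_u /frac_of tofrac_eq0 -size_poly_eq0.
  by rewrite size_polyDl ?size_polyXn ?size_poly1.
by rewrite mulf_eq0 negb_or => /andP[t0 _]; exact: t0.
Qed.

Lemma laurentP f :
  reflect (exists (p : {poly int}) (k : nat), f * uQ ^+ k = frac_of p)
          (f \in laurent_pred).
Proof.
have uk k : uQ ^+ k != 0 by rewrite expf_neq0 // uQ_neq0.
apply: (iffP (asboolP _)) => -[p [k e]]; exists p, k.
  by rewrite e divfK.
by rewrite -e mulfK.
Qed.

Lemma laurent_subring_closed : GRing.subring_closed laurent_pred.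
Proof.
split=> [|x y /laurentP[p [k ep]] /laurentP[q [l eq]]
         |x y /laurentP[p [k ep]] /laurentP[q [l eq]]]; apply/laurentP.
- by exists 1, 0; rewrite mulr1 /frac_of rmorph1.
- exists (p * 'X ^+ l - q * 'X ^+ k), (k + l)%N.
  rewrite /frac_of rmorphB !rmorphM !rmorphXn /=.
  by rewrite -[tofrac p]ep -[tofrac q]eq exprD -[tofrac 'X]/uQ; ring.
- exists (p * q), (k + l)%N.
  by rewrite /frac_of rmorphM /= -/(frac_of p) -/(frac_of q) -ep -eq exprD mulrACA.
Qed.
HB.instance Definition _ :=
  GRing.isSubringClosed.Build Qu laurent_pred laurent_subring_closed.

Definition laurent := {f : Qu | f \in laurent_pred}.
HB.instance Definition _ := SubChoice.on laurent.
HB.instance Definition _ := [SubChoice_isSubComNzRing of laurent by <:].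

Lemma twoQ_laurent : twoQ \in laurent_pred.
Proof. by apply/laurentP; exists ('X ^+ 2 + 1), 1; rewrite expr1 twoQ_u. Qed.

Lemma laurent2P f :
  reflect (exists m : nat, f * twoQ ^+ m \in laurent_pred)
          (f \in laurent2_pred).
Proof.
have tk k : twoQ ^+ k != 0 by rewrite expf_neq0 // twoQ_neq0.
apply: (iffP (asboolP _)) => [[a ha [m ->]]|[m hm]].
  by exists m; rewrite divfK.
by exists (f * twoQ ^+ m) => //; exists m; rewrite mulfK.
Qed.

Lemma laurent2_subring_closed : GRing.subring_closed laurent2_pred.
Proof.
have tX k : twoQ ^+ k \in laurent_pred by rewrite rpredX ?twoQ_laurent.
split=> [|x y /laurent2P[k ex] /laurent2P[l ey]
         |x y /laurent2P[k ex] /laurent2P[l ey]]; apply/laurent2P.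
- by exists 0; rewrite mulr1 rpred1.
- exists (k + l)%N; rewrite mulrBl exprD mulrA [_ ^+ k * _]mulrC mulrA.
  by rewrite rpredB // rpredM.
- by exists (k + l)%N; rewrite exprD mulrACA rpredM.
Qed.
HB.instance Definition _ :=
  GRing.isSubringClosed.Build Qu laurent2_pred laurent2_subring_closed.

Definition laurent2 := {f : Qu | f \in laurent2_pred}.
HB.instance Definition _ := SubChoice.on laurent2.
HB.instance Definition _ := [SubChoice_isSubComNzRing of laurent2 by <:].

Lemma laurent_laurent2 f : f \in laurent_pred -> f \in laurent2_pred.
Proof. by move=> hf; apply/laurent2P; exists 0; rewrite mulr1. Qed.

Definition to_laurent2 (a : laurent) : laurent2 :=
  Sub (val a) (laurent_laurent2 (valP a)).

Lemma u_laurent : uQ \in laurent_pred.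
Proof. by apply/laurentP; exists 'X, 0; rewrite mulr1. Qed.

Lemma uV_laurent : uQ^-1 \in laurent_pred.
Proof.
apply/laurentP; exists 1, 1.
by rewrite expr1 mulVf ?uQ_neq0 // /frac_of rmorph1.
Qed.

Definition u : laurent := Sub uQ u_laurent.
Definition uV : laurent := Sub uQ^-1 uV_laurent.
Definition two : laurent := u + uV.

(* p(1/u) *)
Definition eval_uV (p : {poly int}) : Qu :=
  (map_poly (intr : int -> Qu) p).[uQ^-1].

(* The field automorphism u |-> 1/u of Q(u). *)
Definition barQ (f : Qu) : Qu :=
  let r := generic_quotient.repr (f : {fraction {poly int}}) in
  eval_uV (frac r).1 / eval_uV (frac r).2.

Lemma eval_uVM p q : eval_uV (p * q) = eval_uV p * eval_uV q.
Proof. by rewrite /eval_uV rmorphM hornerM. Qed.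

Lemma eval_uVX k : eval_uV ('X ^+ k) = (uQ ^+ k)^-1.
Proof. by rewrite /eval_uV map_polyXn hornerXn exprVn. Qed.

Lemma eval_uV_rev p : eval_uV p * uQ ^+ (size p).-1 =
  frac_of (\sum_(i < size p) p`_i *: 'X ^+ ((size p).-1 - i)).
Proof.
rewrite /eval_uV (horner_coef_wide _ (size_poly _ _)) mulr_suml.
rewrite /frac_of rmorph_sum; apply: eq_bigr => i _ /=.
rewrite coef_map -mul_polyC rmorphM rmorphXn /= -[tofrac 'X]/uQ -mulrA.
congr (_ * _).
  by rewrite -[in RHS](intz p`_i) rmorph_int /= rmorph_int.
have ile : (i <= (size p).-1)%N by rewrite -ltnS (ltn_predK (ltn_ord i)).
rewrite -[in LHS](subnK ile) exprD exprVn mulrC mulfK //.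
by rewrite expf_neq0 ?uQ_neq0.
Qed.

Lemma eval_uV_eq0 p : (eval_uV p == 0) = (p == 0).
Proof.
apply/idP/eqP => [/eqP e0|->]; last by rewrite /eval_uV rmorph0 horner0.
have /esym/eqP := eval_uV_rev p; rewrite e0 mul0r /frac_of tofrac_eq0 => /eqP e.
apply/eqP; rewrite -lead_coef_eq0; apply/eqP.
have := congr1 (fun q : {poly int} => q`_0) e; rewrite coef0 coef_sum.
case: (posnP (size p)) => [/eqP|sp]; first by rewrite size_poly_eq0 => /eqP ->; rewrite lead_coef0.
have lt : ((size p).-1 < size p)%N by rewrite prednK.
rewrite (bigD1 (Ordinal lt)) //= subnn coefZ coefXn mulr1 big1 ?addr0 //.
move=> i; rewrite -val_eqE /= => ne; rewrite coefZ coefXn eq_sym subn_eq0.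
suff -> : ((size p).-1 <= i)%N = false by rewrite mulr0.
apply/negbTE; rewrite -ltnNge ltn_neqAle ne /= -ltnS prednK //.
Qed.

Lemma mul_denomQ (f : Qu) (r := generic_quotient.repr (f : {fraction {poly int}})) :
  f * frac_of (frac r).2 = frac_of (frac r).1.
Proof.
rewrite -[X in X * _ = _](@reprK _ {fraction {poly int}}) -/r /frac_of.
unlock FracField.tofrac; rewrite -[LHS]FracField.pi_mul; apply/eqmodP => /=.
rewrite FracField.equivfE /FracField.mulf !numden_Ratio ?mulf_neq0 ?oner_neq0 ?denom_ratioP //.
by rewrite !mulr1 mulrC.
Qed.

Lemma barQ_div p q : q != 0 -> barQ (frac_of p / frac_of q) = eval_uV p / eval_uV q.
Proof.
move=> q0; rewrite /barQ; set f := (frac_of p / frac_of q) => /=; move: (mul_denomQ f).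
have fq : frac_of q != 0 by rewrite /frac_of tofrac_eq0.
have fE : f * frac_of q = frac_of p by rewrite /f divfK.
move: (denom_ratioP (generic_quotient.repr f)) => /=.
move: (frac _).1 (frac _).2 => n d d0 e.
have {}e : frac_of (p * d) = frac_of (n * q).
  rewrite /frac_of !rmorphM /= -/(frac_of p) -/(frac_of d) -/(frac_of n).
  by rewrite -e -[tofrac q]/(frac_of q) mulrAC fE.
have {}e : p * d = n * q by apply/eqP; rewrite -tofrac_eq; apply/eqP.
by apply/eqP; rewrite eqr_div ?eval_uV_eq0 // -!eval_uVM e.
Qed.

Lemma eval_uV_laurent p : eval_uV p \in laurent_pred.
Proof. by apply/laurentP; do 2!eexists; apply: eval_uV_rev. Qed.

Lemma barQ_laurent f : f \in laurent_pred -> barQ f \in laurent_pred.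
Proof.
move=> /asboolP[p [k ->]].
have -> : uQ ^+ k = frac_of ('X ^+ k) by rewrite /frac_of rmorphXn.
rewrite barQ_div ?expf_neq0 ?polyX_eq0 // eval_uVX invrK.
by rewrite rpredM ?eval_uV_laurent ?rpredX ?u_laurent.
Qed.

Fact barQ_laurent2_aux (F : fieldType) (x y t : F) k m :
    y != 0 -> t != 0 ->
  x * y^-1 ^+ m / (y^-1 ^+ k * (t / y) ^+ m) * t ^+ m = x * y ^+ k.
Proof.
by move=> y0 t0; rewrite exprMn !exprVn; field; rewrite !expf_neq0.
Qed.

Lemma barQ_laurent2 f : f \in laurent2_pred -> barQ f \in laurent2_pred.
Proof.
move=> /asboolP[_ /asboolP[p [k ->]] [m ->]].
have u0 := uQ_neq0.
have X0 : 'X != 0 :> {poly int} by rewrite polyX_eq0.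
have t0 : 'X ^+ 2 + 1 != 0 :> {poly int}.
  by rewrite -size_poly_eq0 size_polyDl ?size_polyXn ?size_poly1.
have -> : frac_of p / uQ ^+ k / twoQ ^+ m =
          frac_of (p * 'X ^+ m) / frac_of ('X ^+ k * ('X ^+ 2 + 1) ^+ m).
  rewrite /frac_of !rmorphM !rmorphXn /= -[tofrac ('X ^+ 2 + 1)]twoQ_u.
  rewrite -[tofrac 'X]/uQ exprMn !invfM.
  by rewrite -[X in X = _]mulr1 -(@divff _ (uQ ^+ m)) ?expf_neq0 //; ring.
rewrite barQ_div ?mulf_neq0 ?expf_neq0 //.
have e2 : eval_uV ('X ^+ 2 + 1) = twoQ / uQ.
  rewrite /eval_uV rmorphD /= map_polyXn rmorph1 hornerD hornerXn hornerC.
  by rewrite /twoQ mulrDl divff // -expr2 addrC.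
have eX q j : eval_uV (q ^+ j) = eval_uV q ^+ j.
  by rewrite /eval_uV rmorphXn horner_exp.
rewrite !eval_uVM !eX e2; apply/laurent2P; exists m.
rewrite -[eval_uV 'X]/(eval_uV ('X ^+ 1)) eval_uVX expr1.
rewrite (barQ_laurent2_aux (F := Qu) (eval_uV p) k m uQ_neq0 twoQ_neq0).
by rewrite rpredM ?eval_uV_laurent ?rpredX ?u_laurent.
Qed.

Definition bar (a : laurent) : laurent :=
  Sub (barQ (val a)) (barQ_laurent (valP a)).
Definition bar2 (a : laurent2) : laurent2 :=
  Sub (barQ (val a)) (barQ_laurent2 (valP a)).

(* a lies in u^-1 Z[u^-1]. *)
Definition uV_Aminus (a : laurent) : Prop :=
  exists p : {poly int}, val a = uQ^-1 * eval_uV p.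

(* f -> z as u -> 0: the rational function f = p/q is regular at 0, where it
   takes the value z. *)
Definition tends_at0 (f : Qu) (z : int) : Prop :=
  exists p q : {poly int},
    [/\ q.[0] != 0, f = frac_of p / frac_of q & p.[0] = z * q.[0]].

(* [sc] is the scaling of V by R; it is an argument because a module over the
   Hecke algebra is also used as a module over Z[u,u^-1], see [scal]. *)
Definition is_basis (R : nzRingType) (V : zmodType) (sc : R -> V -> V)
    (I : choiceType) (b : I -> V) : Prop :=
  forall x : V, exists! f : {fsfun I -> R with 0},
    x = \sum_(i <- finsupp f) sc (f i) (b i).

Definition semilinear (R : nzRingType) (sigma : R -> R) (V : zmodType)
    (sc : R -> V -> V) (f : V -> V) : Prop :=
  (forall x y, f (x + y) = f x + f y) /\
  (forall a x, f (sc a x) = sc (sigma a) (f x)).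

Definition scal (H : algType laurent) (M : lmodType H) (a : laurent) (x : M) : M :=
  (a%:A : H) *: x.

(* The points are 0, ..., m and [simple i] is the transposition (i, i+1), so
   that the index i : 'I_m stands for s_(i+1), and subsets of S are sets of
   indices. *)
Definition simple (m : nat) (i : 'I_m) : 'S_m.+1 :=
  tperm (widen_ord (leqnSn m) i) (lift ord0 i).

(* The least length of a word in the simple transpositions representing w;
   such a word of length < #|'S_m.+1| always exists. *)
Definition len (m : nat) (w : 'S_m.+1) : nat :=
  find (fun k => [exists t : k.-tuple 'I_m, (\prod_(i <- t) simple i)%g == w])
       (iota 0 #|{: 'S_m.+1}|).

Definition parabolic (m : nat) (K : {set 'I_m}) : {set 'S_m.+1} :=
  <<[set simple i | i in K]>>%g.

(* W^K, for left cosets w W_K. *)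
Definition minreps (m : nat) (K : {set 'I_m}) : {set 'S_m.+1} :=
  [set x | [forall y in (x *: parabolic K)%g, (len x <= len y)%N]].

(* J'_(n-2) = {s_3, ..., s_(n-1)} and S \ s_2 in S_n, where n = m.+2. *)
Definition Jprime (m : nat) : {set 'I_m.+1} := [set i : 'I_m.+1 | (2 <= i)%N].
Definition S_minus_s2 (m : nat) : {set 'I_m.+1} :=
  [set i : 'I_m.+1 | (i : nat) != 1%N].

Section Hecke.

Variables (m : nat) (H : algType laurent) (T : 'S_m.+1 -> H).

Record is_hecke : Prop := IsHecke {
  hecke_basis : is_basis (fun (a : laurent) (h : H) => a *: h) T;
  hecke_mul : forall v w : 'S_m.+1,
    len (v * w)%g = (len v + len w)%N -> T v * T w = T (v * w)%g;
  hecke_quad : forall i : 'I_m,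
    (T (simple i) - u%:A) * (T (simple i) + uV%:A) = 0
}.

Record is_hecke_bar (barH : H -> H) : Prop := IsHeckeBar {
  hecke_bar_semilinear : semilinear bar (fun (a : laurent) (h : H) => a *: h) barH;
  hecke_bar_invol : involutive barH;
  hecke_barT : forall w,
    barH (T w) * T (w^-1)%g = 1 /\ T (w^-1)%g * barH (T w) = 1
}.

Definition Cprime (i : 'I_m) : H := T (simple i) + uV%:A.

(* The subalgebra H_K. *)
Definition hecke_par (K : {set 'I_m}) (h : H) : Prop :=
  exists a : 'S_m.+1 -> laurent, h = \sum_(w in parabolic K) a w *: T w.

(* E = A Gamma, where v : Gamma -> E is the inclusion of the basis. *)
Record is_Wgraph (Gamma : choiceType) (mu : Gamma -> Gamma -> int)
    (L : Gamma -> {set 'I_m}) (E : lmodType H) (v : Gamma -> E) : Prop :=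
  IsWgraph {
  wgraph_basis : is_basis (@scal H E) v;
  wgraph_in : forall i g, i \in L g -> Cprime i *: v g = scal two (v g);
  wgraph_out : forall i g, i \notin L g ->
    exists2 D : {fset Gamma},
      (forall d, (d \in D) = (i \in L d) && (mu d g != 0)) &
      Cprime i *: v g = \sum_(d <- D) v d *~ mu d g
}.

Record is_Wgraph_bar (Gamma : choiceType) (E : lmodType H) (v : Gamma -> E)
    (barE : E -> E) : Prop := IsWgraphBar {
  wgraph_bar_semilinear : semilinear bar (@scal H E) barE;
  wgraph_bar_fix : forall g, barE (v g) = v g
}.

Definition balanced (K : {set 'I_m}) (E : lmodType H) (N : zmodType)
    (f : H -> E -> N) : Prop :=
  [/\ forall h h' e, f (h + h') e = f h e + f h' e,
      forall h e e', f h (e + e') = f h e + f h e' &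
      forall h k e, hecke_par K k -> f (h * k) e = f h (k *: e)].

(* M, with pure tensors h [x] e := t h e, is the tensor product of H and E over
   H_K, with its left H-module structure. *)
Record is_tensor (K : {set 'I_m}) (E M : lmodType H) (t : H -> E -> M) : Prop :=
  IsTensor {
  tensor_balanced : balanced K t;
  tensor_action : forall h h' e, h *: t h' e = t (h * h') e;
  tensor_universal : forall (N : zmodType) (f : H -> E -> N), balanced K f ->
    exists2 g : {additive M -> N},
      (forall h e, g (t h e) = f h e) &
      (forall g' : {additive M -> N},
         (forall h e, g' (t h e) = f h e) -> g' =1 g)
}.

Record is_tensor_bar (barH : H -> H) (E : lmodType H) (barE : E -> E)
    (M : lmodType H) (t : H -> E -> M) (barM : M -> M) : Prop := IsTensorBar {
  tensor_bar_semilinear : semilinear bar (@scal H M) barM;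
  tensor_barE : forall h e, barM (t h e) = t (barH h) (barE e)
}.

(* The index set W^K x Gamma of bases of H [x]_K A Gamma.  Families are given
   as functions on all of W x Gamma, of which only the values on W^K x Gamma
   matter. *)
Definition canon_index (K : {set 'I_m}) (Gamma : choiceType) : choiceType :=
  ({x : 'S_m.+1 | x \in minreps K} * Gamma)%type.

Definition family_on (K : {set 'I_m}) (Gamma : choiceType) (V : Type)
    (c : 'S_m.+1 -> Gamma -> V) (i : canon_index K Gamma) : V :=
  c (val i.1) i.2.

(* The canonical basis of Howlett and Yin. *)
Record is_canonical_basis (K : {set 'I_m}) (Gamma : choiceType)
    (E : lmodType H) (v : Gamma -> E) (M : lmodType H) (t : H -> E -> M)
    (barM : M -> M) (C : 'S_m.+1 -> Gamma -> M) : Prop := IsCanonicalBasis {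
  canonical_basis : is_basis (@scal H M) (family_on (K := K) C);
  canonical_bar : forall w g, w \in minreps K -> barM (C w g) = C w g;
  canonical_congr : forall w g, w \in minreps K ->
    exists2 f : {fsfun canon_index K Gamma -> laurent with 0},
      (forall i, uV_Aminus (f i)) &
      C w g = t (T w) (v g) +
        \sum_(i <- finsupp f)
           scal (f i) (family_on (fun x d => t (T x) (v d)) i)
}.

(* io : M -> M2 is the extension of scalars of M from A to A[1/[2]], i.e. the
   localization of the A-module M at the powers of [2]. *)
Record is_localization (M : lmodType H) (M2 : lmodType laurent2)
    (io : M -> M2) : Prop := IsLocalization {
  loc_add : forall x y, io (x + y) = io x + io y;
  loc_scal : forall a x, io (scal a x) = to_laurent2 a *: io x;
  loc_surj : forall y, exists (x : M) (k : nat),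
    to_laurent2 (two ^+ k) *: y = io x;
  loc_ker : forall x, io x = 0 -> exists k : nat, scal (two ^+ k) x = 0
}.

Record is_localized_bar (M : lmodType H) (M2 : lmodType laurent2)
    (io : M -> M2) (barM : M -> M) (barM2 : M2 -> M2) : Prop :=
  IsLocalizedBar {
  loc_bar_semilinear :
    semilinear bar2 (fun (a : laurent2) (x : M2) => a *: x) barM2;
  loc_bar : forall x, barM2 (io x) = io (barM x)
}.

End Hecke.

(* Main.v *)
Require Import Defs.
From HB Require Import structures.
From mathcomp Require Import all_boot all_order all_fingroup all_algebra.
From mathcomp Require Import finmap boolp ring zify.

Set Implicit Arguments.
Unset Strict Implicit.
Unset Printing Implicit Defensive.

Import GRing.Theory.
Local Open Scope ring_scope.

(** Write K = S \ s_2, J = J'_(n-2) and s = s_1, so that W^J = W^K u W^K s, and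
    C' = C'_s is central in H_K.  An element z of H [x]_K A Gamma is uniquely
    sum_x T_x [x] z_x with x in W^K and z_x in A Gamma.  Since bar fixes T_x up
    to shorter terms, the z_x of maximal length of a bar-invariant z are
    bar-invariant; hence a bar-invariant z with coefficients in A^- is an
    integral combination of canonical basis elements, the coefficients being the
    constant terms.  Applied to h [x] e |-> h [x] (C' - [2]) e, this shows
    that for s in L(g) the components of C~'_(w,g) lie in the [2]-eigenspace of
    C'.  The map h [x] e |-> h C' [x] C' e from H [x]_K A Gamma to
    H [x]_J A Gamma then identifies C~'_(ws,g) with the lift of C~'_(w,g), so
    that beta maps it to [2] C~'_(w,g).  For every other index, the image under
    beta of the canonical basis element differs from the required value by an
    integral combination of C~'_(x,e) with s in L(e), which is removed by
    subtracting the same combination of the C~'_(xs,e) divided by [2]; and 1/[2]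
    tends to 0 with u. *)

(** * Laurent polynomials and the bar involution *)

(** The induced modules are given only by a universal property, so everything is read off
    components. In terms of z = sum_x T_x [x] z_x over W^J, the image under beta has the component
    z_x + T_s z_(xs) at x in W^K, and T_s = C' - u^-1. Here C' is the only source of positive powers
    of u: it multiplies by [2] the coefficients at e with s in L(e). For the canonical basis element
    of (y,g) these lie in u^-1 A^-, except for the leading 1, which meets C' at such an e only if y
    = ws and s in L(g). Those are the indices with image [2] C~'_(w,g); at all others the image has
    coefficients in A^-, so that constant terms determine it. Since C' maps into the span of the e
    with s in L(e), the error has no constant term elsewhere; it is therefore a combination of
    elements that become images after division by [2], and no other denominator occurs. The indices
    used for corrections receive no correction themselves, so the change of basis is 1 - N with N^2
    = 0. Length can replace the Bruhat order because only components of maximal length are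
    compared. *)

Section RationalFunctions.

Implicit Types (p q : {poly int}) (f g : Qu) (n : int).

Lemma eval_uVD p q : eval_uV (p + q) = eval_uV p + eval_uV q.
Proof. by rewrite /eval_uV rmorphD hornerD. Qed.

Lemma eval_uVC n : eval_uV n%:P = n%:~R.
Proof. by rewrite /eval_uV map_polyC hornerC. Qed.

Lemma eval_uV0 : eval_uV 0 = 0.
Proof. by apply/eqP; rewrite eval_uV_eq0. Qed.

Lemma frac_ofC n : frac_of n%:P = n%:~R.
Proof. by rewrite -[n in LHS]intz /frac_of !rmorph_int. Qed.

Lemma Qu_fracP f : exists p q, q != 0 /\ f = frac_of p / frac_of q.
Proof.
have /= := mul_denomQ f; move: (denom_ratioP (generic_quotient.repr (f : {fraction {poly int}}))) => /=.
move: (frac _).1 (frac _).2 => p q q0 e; exists p, q; split=> //.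
by rewrite -e mulfK // /frac_of tofrac_eq0.
Qed.

Lemma frac_of_neq0 q : q != 0 -> frac_of q != 0.
Proof. by rewrite /frac_of tofrac_eq0. Qed.

Lemma barQD f g : barQ (f + g) = barQ f + barQ g.
Proof.
have [p [q [q0 ->]]] := Qu_fracP f; have [p' [q' [q0' ->]]] := Qu_fracP g.
rewrite addf_div ?frac_of_neq0 // /frac_of -!rmorphM -rmorphD /=.
rewrite -!/(frac_of _) !barQ_div ?mulf_neq0 // eval_uVD !eval_uVM addf_div //;
  by rewrite eval_uV_eq0.
Qed.

Lemma barQM f g : barQ (f * g) = barQ f * barQ g.
Proof.
have [p [q [q0 ->]]] := Qu_fracP f; have [p' [q' [q0' ->]]] := Qu_fracP g.
rewrite mulf_div /frac_of -!rmorphM /= -!/(frac_of _) !barQ_div ?mulf_neq0 //.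
by rewrite !eval_uVM mulf_div.
Qed.

Lemma barQ_frac p : barQ (frac_of p) = eval_uV p.
Proof.
have := barQ_div p (oner_neq0 _).
have -> : frac_of 1 = 1 by rewrite /frac_of rmorph1.
by rewrite (eval_uVC 1) mulr1z !divr1.
Qed.

Lemma barQ_int n : barQ n%:~R = n%:~R.
Proof. by rewrite -[in LHS]frac_ofC barQ_frac eval_uVC. Qed.

Lemma barQ_u : barQ uQ = uQ^-1.
Proof. by rewrite barQ_frac /eval_uV map_polyX hornerX. Qed.

Lemma barQV f : barQ f^-1 = (barQ f)^-1.
Proof.
have [->|f0] := eqVneq f 0; first by rewrite invr0 -[0](_ : 0%:~R = 0) // barQ_int invr0.
have e : barQ f * barQ f^-1 = 1 by rewrite -barQM divff // -[1](_ : 1%:~R = 1) // barQ_int.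
have bf0 : barQ f != 0.
  by apply: contra_eq_neq e => ->; rewrite mul0r eq_sym oner_neq0.
by apply: (mulfI bf0); rewrite e divff.
Qed.

Lemma barQ_two : barQ twoQ = twoQ.
Proof. by rewrite barQD barQV barQ_u invrK addrC. Qed.

Lemma barQ_eval_uV p : barQ (eval_uV p) = frac_of p.
Proof.
elim/poly_ind: p => [|p c IH].
  by rewrite -[0]/(0%:P) eval_uVC frac_ofC barQ_int.
have eX : eval_uV 'X = uQ^-1 by rewrite -barQ_u barQ_frac.
rewrite eval_uVD eval_uVM eval_uVC eX barQD barQM IH barQV barQ_u invrK barQ_int.
by rewrite -frac_ofC /frac_of rmorphD rmorphM.
Qed.

End RationalFunctions.

Section LaurentPolynomials.

Implicit Types (a b : laurent) (n : int).

Lemma barrD a b : bar (a + b) = bar a + bar b.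
Proof. by apply: val_inj; rewrite /= barQD. Qed.

Lemma barrM a b : bar (a * b) = bar a * bar b.
Proof. by apply: val_inj; rewrite /= barQM. Qed.

Lemma val_int n : val (n%:~R : laurent) = n%:~R.
Proof. exact: (rmorph_int (val : {rmorphism laurent -> Qu})). Qed.

Lemma bar_int n : bar n%:~R = n%:~R.
Proof. by apply: val_inj; rewrite /= !val_int barQ_int. Qed.

Lemma barr0 : bar 0 = 0.
Proof. by rewrite -(mulr0z 1) bar_int. Qed.

Lemma barrN a : bar (- a) = - bar a.
Proof. by rewrite -mulN1r barrM -[-1]/((-1)%:~R) bar_int mulN1r. Qed.

Lemma bar_u : bar u = uV.
Proof. by apply: val_inj; rewrite /= barQ_u. Qed.

Lemma bar_uV : bar uV = u.
Proof. by apply: val_inj; rewrite /= barQV barQ_u invrK. Qed.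

Lemma bar_two : bar two = two.
Proof. by rewrite /two barrD bar_u bar_uV addrC. Qed.

Lemma mulr_uV : u * uV = 1.
Proof. by apply: val_inj; rewrite /= divff ?uQ_neq0. Qed.

Lemma laurent_mulfI (a b c : laurent) : a != 0 -> a * b = a * c -> b = c.
Proof.
move=> a0 /(congr1 val) /=; rewrite -val_eqE /= in a0.
by move=> /(mulfI a0) e; apply: val_inj.
Qed.

Lemma two_neq0 : two != 0.
Proof. by rewrite -val_eqE /= twoQ_neq0. Qed.

Definition Aminus a : Prop := exists p, val a = eval_uV p.

Lemma Aminus_int n : Aminus n%:~R.
Proof. by exists n%:P; rewrite val_int eval_uVC. Qed.

Lemma AminusD a b : Aminus a -> Aminus b -> Aminus (a + b).
Proof. by move=> [p ep] [q eq]; exists (p + q); rewrite eval_uVD /= ep eq. Qed.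

Lemma AminusM a b : Aminus a -> Aminus b -> Aminus (a * b).
Proof. by move=> [p ep] [q eq]; exists (p * q); rewrite eval_uVM /= ep eq. Qed.

Lemma uV_AminusD a b : uV_Aminus a -> uV_Aminus b -> uV_Aminus (a + b).
Proof. by move=> [p ep] [q eq]; exists (p + q); rewrite eval_uVD mulrDr /= ep eq. Qed.

Lemma uV_AminusM a b : Aminus a -> uV_Aminus b -> uV_Aminus (a * b).
Proof. by move=> [p ep] [q eq]; exists (p * q); rewrite eval_uVM /= ep eq mulrCA. Qed.

Lemma uV_Aminus0 : uV_Aminus 0.
Proof. by exists 0; rewrite eval_uV0 mulr0. Qed.

Lemma uV_AminusN a : uV_Aminus a -> uV_Aminus (- a).
Proof. by move=> ha; rewrite -mulN1r; apply: uV_AminusM => //; apply: (Aminus_int (-1)). Qed.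

Lemma uV_AminusB a b : uV_Aminus a -> uV_Aminus b -> uV_Aminus (a - b).
Proof. by move=> ha hb; apply: uV_AminusD => //; apply: uV_AminusN. Qed.

Lemma uV_Aminus_sum (I : Type) (r : seq I) (P : pred I) (F : I -> laurent) :
  (forall i, P i -> uV_Aminus (F i)) -> uV_Aminus (\sum_(i <- r | P i) F i).
Proof.
move=> hF; elim/big_ind: _ => //; [exact: uV_Aminus0 | exact: uV_AminusD].
Qed.

Lemma Aminus_sum (I : Type) (r : seq I) (P : pred I) (F : I -> laurent) :
  (forall i, P i -> Aminus (F i)) -> Aminus (\sum_(i <- r | P i) F i).
Proof.
move=> hF; elim/big_ind: _ => //; [exact: (Aminus_int 0) | exact: AminusD].
Qed.

Lemma uV_Aminus_sub a : uV_Aminus a -> Aminus a.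
Proof.
move=> [p ep]; exists ('X * p); rewrite ep eval_uVM -['X]/('X^1) eval_uVX expr1 //.
Qed.

Lemma uV_Aminus_uV a : Aminus a -> uV_Aminus (uV * a).
Proof. by move=> [p ep]; exists p; rewrite /= ep. Qed.

Lemma Aminus_two_mul a : uV_Aminus a -> Aminus (two * a).
Proof.
move=> ha; rewrite /two mulrDl; apply: AminusD; last first.
  by apply/uV_Aminus_sub/uV_Aminus_uV/uV_Aminus_sub.
by case: ha => p ep; exists p; rewrite /= ep mulrA divff ?uQ_neq0 // mul1r.
Qed.

Lemma Aminus_constant a : Aminus a -> exists n, uV_Aminus (a - n%:~R).
Proof.
move=> [p]; elim/poly_ind: p a => [a e|p c _ a e].
  by exists 0; rewrite subr0; exists 0; rewrite e eval_uV0 mulr0.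
exists c, p; rewrite rmorphB /= val_int e eval_uVD eval_uVM eval_uVC addrK mulrC.
by rewrite -['X]/('X^1) eval_uVX expr1.
Qed.

(* An element of u^-1 Z[u^-1] has its bar conjugate in u Z[u]. *)
Lemma uV_Aminus_bar0 a : uV_Aminus a -> bar a = a -> a = 0.
Proof.
move=> [p ep] /(congr1 val); rewrite /= ep barQM barQV barQ_u invrK barQ_eval_uV.
have [p0|p0] := eqVneq p 0; first by move=> _; apply: val_inj; rewrite /= ep p0 eval_uV0 mulr0.
move/(congr1 ( *%R^~ (uQ ^+ (size p).-1))).
rewrite -[in RHS]mulrA eval_uV_rev => /(congr1 ( *%R uQ)).
rewrite [in RHS]mulrA divff ?uQ_neq0 // mul1r /uQ /frac_of.
rewrite -!rmorphXn /= -!rmorphM /= => /eqP; rewrite tofrac_eq => /eqP.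
(* [r] is [p] with its coefficients reversed, so its degree is at most that of [p], whereas [e]
   makes it [p] times a positive power of ['X]. *)
set r := \sum_(i < _) _ => e; have : (size r <= size p)%N.
  apply: (leq_trans (size_sum _ _ _)); apply/bigmax_leqP => -[i lt] _ /=.
  by apply: (leq_trans (size_scale_leq _ _)); rewrite size_polyXn; lia.
have -> : r = p * 'X^((size p).-1.+2) by rewrite -e !exprS; ring.
by rewrite size_Mmonic ?monicXn // size_polyXn; have := size_poly_gt0 p; rewrite p0; lia.
Qed.

End LaurentPolynomials.

(** * Limits as u tends to 0 *)

Section Tends.

Implicit Types (f g : Qu) (a b : int).

Lemma tends_at0D f g a b : tends_at0 f a -> tends_at0 g b -> tends_at0 (f + g) (a + b).
Proof.
move=> [p [q [q0 -> ep]]] [p' [q' [q0' -> ep']]].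
have nz r : r.[0] != 0 -> frac_of r != 0.
  by move=> r0; apply: frac_of_neq0; apply: contraNneq r0 => ->; rewrite horner0.
exists (p * q' + p' * q), (q * q'); split.
- by rewrite hornerM mulf_neq0.
- by rewrite addf_div ?nz // /frac_of rmorphD !rmorphM.
- by rewrite hornerD !hornerM ep ep'; ring.
Qed.

Lemma tends_at0N f a : tends_at0 f a -> tends_at0 (- f) (- a).
Proof.
move=> [p [q [q0 -> ep]]]; exists (- p), q; split=> //.
  by rewrite /frac_of rmorphN mulNr.
by rewrite hornerN ep mulNr.
Qed.

Lemma tends_at0_int a : tends_at0 a%:~R a.
Proof. by exists a%:P, 1; rewrite !hornerC mulr1 frac_ofC /frac_of rmorph1 divr1. Qed.

Lemma tends_at0_divtwo a : tends_at0 (a%:~R / twoQ) 0.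
Proof.
(* a / [2] = a u / (u^2 + 1). *)
exists (a%:P * 'X), ('X ^+ 2 + 1); split.
- by rewrite hornerD hornerXn hornerC expr0n.
- rewrite -twoQ_u /frac_of rmorphM /= -!/(frac_of _) frac_ofC -/uQ.
  by rewrite -mulf_div divff ?uQ_neq0 // mulr1.
- by rewrite hornerM hornerX mulr0 mul0r.
Qed.

Lemma tends_at0_sum (I : Type) (r : seq I) (F : I -> Qu) :
  (forall i, tends_at0 (F i) 0) -> tends_at0 (\sum_(i <- r) F i) 0.
Proof.
move=> hF; elim/big_ind: _ => //; first exact: (tends_at0_int 0).
by move=> f g hf hg; rewrite -[0](addr0 (0 : int)); apply: tends_at0D.
Qed.

End Tends.

(** * Lengths in the symmetric group *)

Section SymmetricGroup.

Local Open Scope group_scope.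

Variable m : nat.
Implicit Types (w x y k : 'S_m.+1) (i : 'I_m) (t : seq 'I_m).

Definition word t : 'S_m.+1 := \prod_(i <- t) simple i.

Lemma word_cons i t : word (i :: t) = simple i * word t.
Proof. by rewrite /word big_cons. Qed.

Lemma word_cat t t' : word (t ++ t') = word t * word t'.
Proof. by rewrite /word big_cat. Qed.

Lemma word_rcons t i : word (rcons t i) = word t * simple i.
Proof. by rewrite -cats1 word_cat /word big_seq1. Qed.

Lemma simpleK i : simple i * simple i = 1.
Proof. by rewrite /simple tperm2. Qed.

Lemma simpleV i : (simple i)^-1 = simple i.
Proof. by rewrite /simple tpermV. Qed.

Lemma odd_simple i : odd_perm (simple i).
Proof.
rewrite /simple odd_tperm; apply/eqP => /(congr1 val) /=.
by rewrite /bump leq0n add1n => /eqP; rewrite ltn_eqF.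
Qed.

Lemma odd_word t : odd_perm (word t) = odd (size t).
Proof.
by elim: t => [|i t IH]; rewrite ?word_cons ?odd_permM ?odd_simple ?IH // /word big_nil odd_perm1.
Qed.

Lemma mem_parabolicP (K : {set 'I_m}) w :
  reflect (exists2 t, all (mem K) t & w = word t) (w \in parabolic K).
Proof.
apply: (iffP idP) => [|[t tK ->]]; last first.
  rewrite /word big_seq; apply: group_prod => i it.
  by rewrite mem_gen // imset_f //; apply: (allP tK).
have gP : group_set [set x | `[< exists2 t, all (mem K) t & x = word t >]].
  apply/group_setP; split=> [|x y].
    by rewrite inE; apply/asboolP; exists [::]; rewrite // /word big_nil.
  rewrite !inE => /asboolP[t tK ->] /asboolP[t' tK' ->]; apply/asboolP.
  by exists (t ++ t'); rewrite ?all_cat ?tK ?word_cat.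
rewrite /parabolic => h.
have: w \in Group gP.
  apply: (subsetP _ _ h); rewrite gen_subG; apply/subsetP => _ /imsetP[i iK ->].
  by rewrite inE; apply/asboolP; exists [:: i]; rewrite /= ?iK // /word big_seq1.
by rewrite inE => /asboolP.
Qed.

(** The transpositions (0 z) generate, and (0 z+1) is the conjugate of (0 z) by the simple
    transposition of z and z+1. *)
Lemma mem_parabolicT w : w \in parabolic [set: 'I_m].
Proof.
set G := parabolic _.
have sG i : simple i \in G by rewrite mem_gen // imset_f.
have t0 (z : 'I_m.+1) : tperm ord0 z \in G.
  case: z => z; elim: z => [|z IH] lt.
    by rewrite (_ : Ordinal lt = ord0) ?tperm1 ?group1 //; apply: val_inj.
  have lt' : (z < m)%N by [].
  have [->|->] // : tperm ord0 (Ordinal lt) = simple (Ordinal lt') \/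
            tperm ord0 (Ordinal lt) =
            tperm ord0 (Ordinal (ltnW lt)) ^ simple (Ordinal lt').
    case: (posnP z) => z0; [left | right].
      rewrite /simple; congr tperm; apply: val_inj => //=.
    rewrite tpermJ /simple; congr tperm.
      by rewrite tpermD // -val_eqE /= -?lt0n // gtn_eqF.
    rewrite [X in tperm _ _ X](_ : _ = widen_ord (leqnSn m) (Ordinal lt')).
      by rewrite tpermL; apply: val_inj.
    exact: val_inj.
  by rewrite groupJ.
have [ts -> _] := prod_tpermP w; apply: group_prod => -[x y] _ /=.
have -> : tperm x y = if x == y then 1 else
    if x == ord0 then tperm ord0 y else
    if y == ord0 then tperm ord0 x else tperm ord0 y ^ tperm ord0 x.
  case: eqP => [->|/eqP xy]; first by rewrite tperm1.
  case: eqP => [->|/eqP x0] //.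
  case: eqP => [->|/eqP y0]; first by rewrite tpermC.
  by rewrite tpermJ tpermL tpermD // eq_sym.
by do 3!case: ifP => _ //; rewrite ?groupJ.
Qed.

Lemma len_word_le t : (len (word t) <= size t)%N.
Proof.
(* [find] returns the length of the list when the search fails, so [len] never exceeds the order of
   the group and long words satisfy the bound trivially. *)
have [lt|ge] := ltnP (size t) #|{: 'S_m.+1}|; last first.
  by rewrite (leq_trans _ ge) // /len (leq_trans (find_size _ _)) ?size_iota.
rewrite /len leqNgt; apply/negP => h.
have := before_find 0%N h; rewrite nth_iota // add0n => /existsP[].
by exists (in_tuple t); rewrite /word.
Qed.

(** Two equal prefix products allow a word to be cut, so by the pigeonhole principle a shortest word
    has fewer letters than the group has elements. This makes the bounded search in [len]
    succeed. *)
Lemma short_word w : exists t, word t = w /\ (size t < #|{: 'S_m.+1}|)%N.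
Proof.
have [t0 _ /esym e0] := mem_parabolicP _ w (mem_parabolicT w).
pose P n := `[< exists t, size t = n /\ word t = w >].
have exP : exists n, P n by exists (size t0); apply/asboolP; exists t0.
case: (ex_minnP exP) => n /asboolP[t [st et]] minn; exists t; split=> //.
rewrite ltnNge; apply/negP => big.
pose f (j : 'I_n.+1) := word (take j t).
have /injectivePn[i [j ij fij]] : ~~ injectiveb f.
  apply/negP => /injectiveP/leq_card; rewrite card_ord leqNgt => /negP; apply.
  by rewrite ltnS -st.
wlog lt : i j ij fij / (i < j)%N => [hw|].
  have /orP[|] : (i < j)%N || (j < i)%N by rewrite -neq_ltn.
    exact: hw.
  by apply: hw => //; rewrite eq_sym.
have : P (i + (n - j))%N.
  apply/asboolP; exists (take i t ++ drop j t); split.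
    rewrite size_cat size_takel ?size_drop ?st //.
    by rewrite -ltnS ltn_ord.
  rewrite word_cat -/(f i) fij -word_cat cat_take_drop //.
move/minn; have := ltn_ord j; lia.
Qed.

Lemma len_wordP w : exists2 t, word t = w & size t = len w.
Proof.
have [t [tw st]] := short_word w.
have : has (fun n => [exists t : n.-tuple 'I_m, (\prod_(i <- t) simple i)%g == w])
         (iota 0 #|{: 'S_m.+1}|).
  apply/hasP; exists (size t); first by rewrite mem_iota.
  by apply/existsP; exists (in_tuple t); rewrite -/(word _) tw.
move=> h; have := nth_find 0%N h; move: h; rewrite has_find size_iota => h.
rewrite nth_iota // add0n => /existsP[t' /eqP e].
by exists t' => //; rewrite size_tuple.
Qed.

Lemma odd_len w : odd (len w) = odd_perm w.
Proof. by have [t <- <-] := len_wordP w; rewrite odd_word. Qed.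

Lemma len1 : len (1 : 'S_m.+1) = 0%N.
Proof. by apply/eqP; rewrite -leqn0; have := len_word_le [::]; rewrite /word big_nil. Qed.

Lemma len_eq0 w : (len w == 0%N) = (w == 1).
Proof.
apply/eqP/eqP => [|->]; last exact: len1.
by have [[|i t] <- <-] := len_wordP w; rewrite /word ?big_nil.
Qed.

Lemma len_mul_le x y : (len (x * y) <= len x + len y)%N.
Proof.
have [t <- <-] := len_wordP x; have [t' <- <-] := len_wordP y.
by rewrite -word_cat -size_cat len_word_le.
Qed.

Lemma len_simple i : len (simple i) = 1%N.
Proof.
have := len_word_le [:: i]; rewrite /word big_seq1 /=.
have := odd_len (simple i); rewrite odd_simple; case: (len _) => [|[|]] //.
Qed.

Lemma lenV w : len w^-1 = len w.
Proof.
suff le (v : 'S_m.+1) : (len v^-1 <= len v)%N.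
  by apply/eqP; rewrite eqn_leq le -{1}(invgK w) le.
have [t <- <-] := len_wordP v; elim: t => [|i t IH].
  by rewrite /word big_nil invg1 len1.
rewrite word_cons invMg simpleV /= (leq_trans (len_mul_le _ _)) //.
by rewrite len_simple addn1 ltnS.
Qed.

Lemma len_mulr_simple w i :
  len (w * simple i) = (len w).+1 \/ len w = (len (w * simple i)).+1.
Proof.
have h1 := len_mul_le w (simple i).
have h2 := len_mul_le (w * simple i) (simple i).
rewrite -mulgA simpleK mulg1 len_simple in h2; rewrite len_simple in h1.
have : len (w * simple i) != len w.
  by apply/eqP => /(congr1 odd); rewrite !odd_len odd_permM odd_simple; case: odd_perm.
by move: h1 h2; set a := len _; set b := len w; lia.
Qed.

Lemma len_mull_simple w i :
  len (simple i * w) = (len w).+1 \/ len w = (len (simple i * w)).+1.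
Proof.
have e : len (simple i * w) = len (w^-1 * simple i) by rewrite -lenV invMg simpleV.
by have := len_mulr_simple w^-1 i; rewrite -e lenV.
Qed.

Lemma simpleE i (z : 'I_m.+1) : simple i z =
  (if z == i :> nat then i.+1 else if z == i.+1 :> nat then (i : nat) else z) :> nat.
Proof.
rewrite /simple; case: tpermP => [->|->|]; rewrite ?eqxx //=.
  by rewrite /bump leq0n add1n gtn_eqF ?eqxx.
move=> n1 n2; case: eqP => [e|_]; first by case: n1; apply: val_inj.
by case: eqP => // e; case: n2; apply: val_inj.
Qed.

(* A right descent of w, read off the inverse of w because [(w * s) z] is
   [s (w z)]. *)
Definition descent w i : bool := (w^-1 (lift ord0 i) < w^-1 (widen_ord (leqnSn m) i))%N.

(** Letters are prepended until the descent appears. The letter [a] that creates it reverses the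
    order of two values p < q, which forces p = a and q = a + 1; so s_a is the conjugate of s_i by
    the remaining word, and multiplying by s_i deletes it. *)
Lemma exchange_descent t i : descent (word t) i ->
  exists t1 a t2, t = t1 ++ a :: t2 /\ word t * simple i = word (t1 ++ t2).
Proof.
elim: t => [|a t IH]; first by rewrite /descent /word big_nil invg1 !perm1 /= /bump; lia.
case: (boolP (descent (word t) i)) => [/IH[t1 [b [t2 [-> e]]]] _|nd].
  exists (a :: t1), b, t2; split=> //.
  by rewrite [in LHS]word_cons -mulgA e cat_cons word_cons.
rewrite {1}/descent word_cons invMg simpleV !permM.
set p := (word t)^-1 (widen_ord _ i); set q := (word t)^-1 (lift ord0 i).
have pq : p != q.
  rewrite (inj_eq perm_inj) -val_eqE /= /bump; lia.
have {}nd : (p < q)%N by rewrite ltn_neqAle pq leqNgt.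
rewrite !simpleE => flip.
have [ep eq] : p = a :> nat /\ q = a.+1 :> nat.
  by move: flip; do 4?case: eqP; lia.
exists [::], a, t; split=> //=.
have -> : simple a = simple i ^ (word t)^-1.
  by rewrite {2}/simple tpermJ /simple; congr tperm; apply: val_inj.
by rewrite conjgE invgK !mulgA mulgKV -mulgA simpleK mulg1.
Qed.

Lemma descentP w i : descent w i = (len (w * simple i) < len w)%N.
Proof.
have dlt x : descent x i -> (len (x * simple i) < len x)%N.
  have [t <- <-] := len_wordP x => /exchange_descent[t1 [a [t2 [-> ->]]]].
  by rewrite (leq_ltn_trans (len_word_le _)) // !size_cat /= addnS.
apply/idP/idP => [/dlt //|]; apply: contraTT => nd.
have /dlt : descent (w * simple i) i.
  rewrite /descent invMg simpleV !permM /simple tpermL tpermR.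
  rewrite ltn_neqAle leqNgt nd andbT val_eqE (inj_eq perm_inj) -val_eqE /= /bump; lia.
by rewrite -mulgA simpleK mulg1 -leqNgt => /ltnW.
Qed.

Lemma exchange t i : (len (word t * simple i) < len (word t))%N ->
  exists t1 a t2, t = t1 ++ a :: t2 /\ word t * simple i = word (t1 ++ t2).
Proof. by rewrite -descentP => /exchange_descent. Qed.

(** The exchange condition only deletes letters, so shortening a word in K never leaves K. *)
Lemma parabolic_reduced (K : {set 'I_m}) k : k \in parabolic K ->
  exists t, [/\ all (mem K) t, word t = k & size t = len k].
Proof.
move=> /mem_parabolicP[t + ->]; elim/last_ind: t => [|t i IH].
  by exists [::]; rewrite /word big_nil len1.
rewrite all_rcons => /andP[iK /IH[t' [tK' e st]]]; rewrite word_rcons -e.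
have [up|down] := len_mulr_simple (word t') i.
  by exists (rcons t' i); rewrite all_rcons iK tK' word_rcons size_rcons up e -st.
have [|t1 [a [t2 [et e']]]] := @exchange t' i; first by rewrite down.
exists (t1 ++ t2); split=> //.
  by move: tK'; rewrite et !all_cat /= => /and3P[-> _ ->].
apply/eqP; rewrite eqn_leq e' len_word_le -e' andbT.
by rewrite -ltnS -down e -st et !size_cat /= addnS.
Qed.

Lemma parabolic_simple (K : {set 'I_m}) i : i \in K -> simple i \in parabolic K.
Proof. by move=> iK; rewrite mem_gen // imset_f. Qed.

(** Induction on a reduced word of k. If appending s_i to x k lowered the length, the exchange
    condition would delete a letter of a reduced word of x or of k, and both are impossible. *)
Lemma len_minreps_mul (K : {set 'I_m}) x k :
  x \in minreps K -> k \in parabolic K -> len (x * k) = (len x + len k)%N.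
Proof.
move=> xK /parabolic_reduced[t [+ <-]].
elim/last_ind: t => [|t i IH]; first by rewrite /word big_nil mulg1 len1 addn0.
rewrite all_rcons size_rcons => /andP[iK tK] st.
have kK : word t \in parabolic K by apply/mem_parabolicP; exists t.
have st' : size t = len (word t).
  apply/eqP; rewrite eqn_leq len_word_le andbT -ltnS st word_rcons.
  by rewrite (leq_trans (len_mul_le _ _)) // len_simple addn1.
have {}IH := IH tK st'; rewrite -st word_rcons mulgA.
have [->|] := len_mulr_simple (x * word t) i; first by rewrite IH -st' addnS.
have [r er sr] := len_wordP x; rewrite -er -word_cat => down.
have [|t1 [a [t2 [et e']]]] := @exchange (r ++ t) i; first by rewrite down.
have minx y : y \in parabolic K -> (len x <= len (x * y))%N.
  by move=> yK; move: xK; rewrite inE => /forall_inP; apply; rewrite mem_lcoset mulKg.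
(* The deleted letter belongs to [t]: then [word t * simple i] has a word shorter than its
   length. *)
have [l|l] := leqP (size r) (size t1).
  have et1 : t1 = r ++ drop (size r) t1.
    rewrite -{1}(cat_take_drop (size r) t1); congr (_ ++ _).
    by have := congr1 (take (size r)) et; rewrite take_size_cat // takel_cat.
  move: et e'; rewrite et1 -catA => /eqP; rewrite eqseq_cat // eqxx /= => /eqP et.
  rewrite word_cat -catA word_cat -mulgA => /mulgI e.
  have := len_word_le (drop (size r) t1 ++ t2).
  by rewrite -e -word_rcons -st et !size_cat /=; lia.
(* The deleted letter belongs to [r]: then a conjugate of s_i in W_K carries x to a shorter element
   of its coset. *)
have : x * (word t * simple i * (word t)^-1) = word (t1 ++ drop (size t1).+1 r).
  apply: (mulIg (word t)); rewrite -er !mulgA mulgKV -word_cat e' -word_cat -catA; congr (word (_ ++ _)).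
  have := congr1 (drop (size t1).+1) et.
  rewrite drop_cat; move: l; rewrite leq_eqVlt => /orP[/eqP l|l].
    rewrite -l ltnn subnn drop0 -cat_rcons drop_size_cat ?size_rcons //.
    by rewrite l drop_size => ->.
  by rewrite l -cat_rcons drop_size_cat ?size_rcons.
move=> e2; have yK : word t * simple i * (word t)^-1 \in parabolic K.
  by rewrite !groupM ?groupV ?parabolic_simple.
have := minx _ yK; rewrite e2 => /leq_trans/(_ (len_word_le _)).
by rewrite size_cat size_drop -sr; lia.
Qed.

End SymmetricGroup.

(** * Minimal coset representatives *)

Section Cosets.

Local Open Scope group_scope.

Variables (m : nat) (K : {set 'I_m}).
Implicit Types (x y : 'S_m.+1).

Lemma minreps_min x y : x \in minreps K -> x^-1 * y \in parabolic K -> (len x <= len y)%N.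
Proof. by rewrite inE => /forall_inP h xy; apply: h; rewrite mem_lcoset. Qed.

Lemma minreps_exists y : exists2 x, x \in minreps K & x^-1 * y \in parabolic K.
Proof.
have Py : y^-1 * y \in parabolic K by rewrite mulVg group1.
case: (arg_minnP (@len m) (P := fun x => x^-1 * y \in parabolic K) Py) => x xy minx.
exists x => //; rewrite inE; apply/forall_inP => z; rewrite mem_lcoset => xz.
apply: minx; rewrite -[y](mulKVg x) mulgA groupM //.
by rewrite -groupV invMg invgK.
Qed.

Lemma minreps_inj x y :
  x \in minreps K -> y \in minreps K -> x^-1 * y \in parabolic K -> x = y.
Proof.
move=> xK yK xy; have := len_minreps_mul xK xy; rewrite mulKVg.
have yx : y^-1 * x \in parabolic K by rewrite -groupV invMg invgK.
move=> e; have le : (len y <= len x)%N := minreps_min yK yx.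
have : len (x^-1 * y) == 0%N by lia.
by rewrite len_eq0 -eq_invg_mul invgK => /eqP.
Qed.

Lemma mem_minrepsV x y : x \in minreps K -> y \in minreps K ->
  (x^-1 * y \in parabolic K) = (x == y).
Proof.
move=> xK yK; apply/idP/eqP => [/(minreps_inj xK yK)//|->].
by rewrite mulVg group1.
Qed.

End Cosets.

(** * Comparison of W^J and W^K *)

Section TwoCosets.

Local Open Scope group_scope.

Variable m : nat.
Implicit Types (w x y : 'S_m.+2).

Local Notation J := (Jprime m).
Local Notation K := (S_minus_s2 m).
Local Notation s0 := (simple (ord0 : 'I_m.+1)).

Lemma simple_commute (i : 'I_m.+1) : i \in J -> s0 * simple i = simple i * s0.
Proof.
rewrite inE => i2; apply/permP => z; apply: ord_inj; rewrite !permM !simpleE /=.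
by do !case: eqP => //=; lia.
Qed.

Lemma sub_Jprime : J \subset K.
Proof. by apply/subsetP => i; rewrite !inE; case: (i : nat) => [|[]]. Qed.

Lemma sub_parabolic x : x \in parabolic J -> x \in parabolic K.
Proof. by apply: subsetP; apply: genS; apply/imsetS/sub_Jprime. Qed.

Lemma s0_parabolic : s0 \in parabolic K.
Proof. by apply: parabolic_simple; rewrite inE. Qed.

(** W_J fixes the point 0, which s moves. *)
Lemma s0_Nparabolic : s0 \notin parabolic J.
Proof.
apply/negP => /mem_parabolicP[t tJ e].
have : word t ord0 = ord0.
  elim: t tJ {e} => [|i t IH] /=; first by rewrite /word big_nil perm1.
  rewrite word_cons permM inE => /andP[i2 /IH {2}<-]; congr (word t _).
  by apply: ord_inj; rewrite simpleE /=; move: i2; case: (i : nat) => [|[]].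
by rewrite -e => /(congr1 (@nat_of_ord _)); rewrite simpleE.
Qed.

(** Since s commutes with W_J, the group W_K is the union of W_J and s W_J. *)
Lemma parabolic_split k : k \in parabolic K -> (k \in parabolic J) || (s0 * k \in parabolic J).
Proof.
move=> /mem_parabolicP[t + ->]; elim: t => [|i t IH] /=.
  by rewrite /word big_nil group1.
rewrite word_cons => /andP[iK /IH {}IH].
have [i0|iJ] : i = ord0 \/ i \in J.
  move: iK; rewrite !inE => i1; case: (posnP i) => i0; first by left; apply: val_inj.
  by right; lia.
  by rewrite i0 mulgA simpleK mul1g orbC.
have sJ := parabolic_simple iJ.
by rewrite groupMl // [X in _ || (X \in _)]mulgA simple_commute // -mulgA groupMl.
Qed.

Lemma minreps_KJ w : w \in minreps K -> w \in minreps J.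
Proof.
move=> wK; rewrite inE; apply/forall_inP => y; rewrite mem_lcoset => /sub_parabolic.
exact: minreps_min.
Qed.

Lemma len_mul_s0 w : w \in minreps K -> len (w * s0) = (len w).+1.
Proof. by move=> wK; rewrite (len_minreps_mul wK s0_parabolic) len_simple addn1. Qed.

Lemma minreps_KsJ w : w \in minreps K -> w * s0 \in minreps J.
Proof.
move=> wK; rewrite inE; apply/forall_inP => y; rewrite mem_lcoset => yJ.
set k := (w * s0)^-1 * y in yJ; have -> : y = w * (s0 * k) by rewrite mulgA mulKVg.
have skK : s0 * k \in parabolic K by rewrite groupM ?s0_parabolic ?sub_parabolic.
rewrite (len_minreps_mul wK skK) (len_minreps_mul wK s0_parabolic).
rewrite leq_add2l len_simple lt0n len_eq0.
apply: contra s0_Nparabolic => /eqP e.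
by rewrite -groupV -[s0^-1]mulg1 -e mulKg.
Qed.

Lemma minreps_KsNK w : w \in minreps K -> w * s0 \notin minreps K.
Proof.
move=> wK; apply/negP => wsK; have := mem_minrepsV wK wsK.
rewrite mulKg s0_parabolic => /esym/eqP/(congr1 (@len m.+1)).
by rewrite len_mul_s0 // => /eqP; rewrite ltn_eqF.
Qed.

Lemma minreps_JP y : y \in minreps J ->
  y \in minreps K \/ exists2 w, w \in minreps K & y = w * s0.
Proof.
move=> yJ; have [x xK xy] := minreps_exists K y.
have /orP[h|h] := parabolic_split xy.
  by left; rewrite -(minreps_inj (minreps_KJ xK) yJ h).
right; exists x => //; apply/esym/(minreps_inj (minreps_KsJ xK) yJ).
by rewrite invMg simpleV -mulgA.
Qed.

Lemma mem_minrepsVs w x : x \in minreps K -> w \in minreps K ->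
  (x^-1 * (w * s0) \in parabolic K) = (x == w).
Proof. by move=> xK wK; rewrite mulgA groupMr ?s0_parabolic // mem_minrepsV. Qed.

End TwoCosets.

(** * Coordinates with respect to a basis *)

(** The module axioms for an operation passed as an argument, so that coordinates are developed once
    for both [*:] and the action [scal] of A on an H-module. *)
Record is_scaling (R : nzRingType) (V : zmodType) (sc : R -> V -> V) : Prop :=
  IsScaling {
  scalingDl : forall a b x, sc (a + b) x = sc a x + sc b x;
  scalingDr : forall a x y, sc a (x + y) = sc a x + sc a y;
  scalingA : forall a b x, sc (a * b) x = sc a (sc b x);
  scaling1 : forall x, sc 1 x = x
}.

Lemma lmod_scaling (R : nzRingType) (V : lmodType R) :
  is_scaling (fun (a : R) (x : V) => a *: x).
Proof.
by split=> *; rewrite ?scalerDl ?scalerDr ?scalerA ?scale1r.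
Qed.

Lemma scal_scaling (H : algType laurent) (M : lmodType H) : is_scaling (@scal H M).
Proof.
split=> [a b x|a x y|a b x|x]; rewrite /scal ?scalerDl ?scalerDr ?scale1r //.
by rewrite scalerA -scalerAl mul1r scalerA.
Qed.

Section Coordinates.

Variables (R : nzRingType) (V : zmodType) (sc : R -> V -> V) (I : choiceType) (b : I -> V).
Hypotheses (scP : is_scaling sc) (bP : is_basis sc b).
Implicit Types (x y : V) (a c : R) (i j : I).

Lemma scaling0l x : sc 0 x = 0.
Proof. by apply: (addrI (sc 0 x)); rewrite -(scalingDl scP) !addr0. Qed.

Lemma scaling0r a : sc a 0 = 0.
Proof. by apply: (addrI (sc a 0)); rewrite -(scalingDr scP) !addr0. Qed.

Lemma scalingNl a x : sc (- a) x = - sc a x.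
Proof. by apply/eqP; rewrite -subr_eq0 opprK -(scalingDl scP) addNr scaling0l. Qed.

Lemma scaling_sumr (J : Type) (r : seq J) (P : pred J) a (F : J -> V) :
  sc a (\sum_(j <- r | P j) F j) = \sum_(j <- r | P j) sc a (F j).
Proof. exact: (big_morph _ (scalingDr scP a) (scaling0r a)). Qed.

Definition crd x : {fsfun I -> R with 0} := sval (cid (bP x)).

Lemma crdE x : x = \sum_(i <- finsupp (crd x)) sc (crd x i) (b i).
Proof. by rewrite /crd; case: cid => f []. Qed.

Lemma crd_widen x (A : {fset I}) : (finsupp (crd x) `<=` A)%fset ->
  x = \sum_(i <- A) sc (crd x i) (b i).
Proof.
move=> sA; rewrite [LHS]crdE; apply: big_fset_incl => // i _ /fsfun_dflt ->.
exact: scaling0l.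
Qed.

Lemma crd_lincomb (A : {fset I}) (f : I -> R) j :
  crd (\sum_(i <- A) sc (f i) (b i)) j = if j \in A then f j else 0.
Proof.
set x := \sum_(i <- A) _; pose g : {fsfun I -> R with 0} := [fsfun i in A => f i].
have gE i : g i = if i \in A then f i else 0 by rewrite /g fsfunE.
have xE : x = \sum_(i <- finsupp g) sc (g i) (b i).
  rewrite (big_fset_incl _ (_ : finsupp g `<=` A)%fset).
  - by apply: eq_big_seq => i iA; rewrite gE iA.
  - by apply/fsubsetP => i; rewrite mem_finsupp gE; case: ifP => //; rewrite eqxx.
  - by move=> i _ /fsfun_dflt ->; apply: scaling0l.
rewrite /crd; case: cid => h /= [_ u].
by rewrite (u _ xE) gE.
Qed.

Lemma crdD x y i : crd (x + y) i = crd x i + crd y i.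
Proof.
set A := (finsupp (crd x) `|` finsupp (crd y))%fset.
rewrite {1}(crd_widen (fsubsetUl _ _ : (_ `<=` A)%fset)).
rewrite {1}(crd_widen (fsubsetUr _ _ : (_ `<=` A)%fset)) -big_split /=.
under eq_bigr do rewrite -(scalingDl scP).
rewrite crd_lincomb; case: ifPn => //; rewrite in_fsetU negb_or => /andP[xi yi].
by rewrite !fsfun_dflt ?addr0.
Qed.

Lemma crdZ a x i : crd (sc a x) i = a * crd x i.
Proof.
rewrite {1}(crdE x) scaling_sumr; under eq_bigr do rewrite -(scalingA scP).
by rewrite crd_lincomb; case: ifPn => // /fsfun_dflt ->; rewrite mulr0.
Qed.

Lemma crd0 i : crd 0 i = 0.
Proof. by rewrite -(scaling0r 0) crdZ mul0r. Qed.

Lemma crdN x i : crd (- x) i = - crd x i.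
Proof. by apply/eqP; rewrite -subr_eq0 opprK -crdD addNr crd0. Qed.

Lemma crdB x y i : crd (x - y) i = crd x i - crd y i.
Proof. by rewrite crdD crdN. Qed.

Lemma crd_sum (J : Type) (r : seq J) (P : pred J) (F : J -> V) i :
  crd (\sum_(j <- r | P j) F j) i = \sum_(j <- r | P j) crd (F j) i.
Proof. exact: (big_morph (fun x => crd x i) (fun x y => crdD x y i) (crd0 i)). Qed.

Lemma crd_basis i j : crd (b i) j = (i == j)%:R.
Proof.
have -> : b i = \sum_(k <- [fset i]%fset) sc 1 (b k).
  by rewrite big_seq_fset1 (scaling1 scP).
by rewrite crd_lincomb inE eq_sym; case: eqP.
Qed.

Lemma crd_inj x y : (forall i, crd x i = crd y i) -> x = y.
Proof. by move=> e; rewrite (crdE x) (crdE y); have /fsfunP -> := e. Qed.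

Lemma basis_ind (P : V -> Prop) : P 0 -> (forall x y, P x -> P y -> P (x + y)) ->
  (forall a i, P (sc a (b i))) -> forall x, P x.
Proof. by move=> P0 PD PZ x; rewrite (crdE x); elim/big_ind: _. Qed.

End Coordinates.

(** * The Hecke algebra *)

Section HeckeAlgebra.

Variables (m : nat) (H : algType laurent) (T : 'S_m.+1 -> H).
Hypothesis hH : is_hecke T.
Implicit Types (w x y k : 'S_m.+1) (h : H) (i : 'I_m) (a : laurent) (K : {set 'I_m}).

Local Notation Ts i := (T (simple i)).
Local Notation hb := (hecke_basis hH).

Lemma hecke_ind (P : H -> Prop) : P 0 -> (forall h h', P h -> P h' -> P (h + h')) ->
  (forall a w, P (a *: T w)) -> forall h, P h.
Proof. exact: (basis_ind hb). Qed.

Lemma T1 : T 1%g = 1.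
Proof.
suff T1l h : T 1%g * h = h by rewrite -[T _]mulr1 T1l.
elim/hecke_ind: h => [|h h' IH IH'|a w]; first by rewrite mulr0.
  by rewrite mulrDr IH IH'.
by rewrite -scalerAr (hecke_mul hH) ?mul1g // len1.
Qed.

Lemma Ts_sqr i : Ts i * Ts i = (u - uV) *: Ts i + 1.
Proof.
have := hecke_quad hH i; rewrite mulrBl !mulrDr -!scalerAr -!scalerAl !mulr1 !mul1r.
rewrite scalerA [uV * u]mulrC mulr_uV scale1r => /eqP; rewrite subr_eq0 => /eqP e.
by apply: (addIr (uV *: Ts i)); rewrite e scalerBl [RHS]addrAC subrK.
Qed.

Lemma T_mulr_simple y i : T y * Ts i =
  if (len y < len (y * simple i)%g)%N then T (y * simple i)%g
  else (u - uV) *: T y + T (y * simple i)%g.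
Proof.
have [up|down] := len_mulr_simple y i; first by rewrite up ltnS leqnn hecke_mul // len_simple up addn1.
rewrite ltnNge down leqnSn /=.
have -> : T y = T (y * simple i)%g * Ts i.
  by rewrite hecke_mul // -?mulgA ?simpleK ?mulg1 // len_simple addn1 -down.
by rewrite -mulrA Ts_sqr mulrDr mulr1 scalerAr.
Qed.

Lemma T_mull_simple y i : Ts i * T y =
  if (len y < len (simple i * y)%g)%N then T (simple i * y)%g
  else (u - uV) *: T y + T (simple i * y)%g.
Proof.
have [up|down] := len_mull_simple y i; first by rewrite up ltnS leqnn hecke_mul // len_simple up add1n.
rewrite ltnNge down leqnSn /=.
have -> : T y = Ts i * T (simple i * y)%g.
  by rewrite hecke_mul // ?mulgA ?simpleK ?mul1g // len_simple add1n -down.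
by rewrite mulrA Ts_sqr mulrDl mul1r scalerAl.
Qed.

Lemma Ts_Cprime i : Ts i * Cprime T i = u *: Cprime T i.
Proof.
rewrite /Cprime mulrDr Ts_sqr -scalerAr mulr1 scalerDr scalerA mulr_uV scale1r.
by rewrite addrAC -scalerDl subrK.
Qed.

Lemma Cprime_Ts i : Cprime T i * Ts i = u *: Cprime T i.
Proof.
rewrite /Cprime mulrDl Ts_sqr -scalerAl mul1r scalerDr scalerA mulr_uV scale1r.
by rewrite addrAC -scalerDl subrK.
Qed.

Lemma hecke_par_T K w : w \in parabolic K -> hecke_par T K (T w).
Proof.
move=> wK; exists (fun w' => (w' == w)%:R); rewrite (bigD1 w) //= eqxx scale1r.
by rewrite big1 ?addr0 // => w' /andP[_ /negPf ->]; rewrite scale0r.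
Qed.

Lemma hecke_par_scalar K a : hecke_par T K a%:A.
Proof.
have [b e] := hecke_par_T (group1 (parabolic K)); exists (fun w => a * b w).
by rewrite -T1 e scaler_sumr; apply: eq_bigr => w _; rewrite scalerA.
Qed.

(** An element of W_K has a reduced word in K, so its T_w is a product of generators T_s with s in
    K. *)
Lemma hecke_par_ind K (P : H -> Prop) : P 1 ->
  (forall h h', P h -> P h' -> P (h + h')) -> (forall h h', P h -> P h' -> P (h * h')) ->
  (forall a h, P h -> P (a *: h)) -> (forall i, i \in K -> P (Ts i)) ->
  forall h, hecke_par T K h -> P h.
Proof.
move=> P1 PD PM PZ Ps _ [a ->].
have PT w : w \in parabolic K -> P (T w).
  move=> /parabolic_reduced[t [+ <-]]; elim: t => [|i t IH] /=.
    by rewrite /word big_nil T1.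
  rewrite word_cons => /andP[iK tK] st; have le := len_word_le t.
  have [up|down] := len_mull_simple (word t) i; last first.
    by move: le; rewrite down -st ltnNge ltnW.
  have st' : size t = len (word t) by move: st; rewrite up => -[].
  rewrite -(hecke_mul hH) ?len_simple ?up ?add1n //.
  by apply: PM; [apply: Ps | apply: IH].
elim/big_ind: _ => //; last by move=> w /PT; apply: PZ.
by rewrite -(scale0r 1); apply: PZ.
Qed.

(** The length filtration of the Hecke algebra, used in place of the Bruhat order. *)
Definition shorter (n : nat) h : Prop :=
  exists a : 'S_m.+1 -> laurent, h = \sum_(y | (len y < n)%N) a y *: T y.

Lemma shorterD n h h' : shorter n h -> shorter n h' -> shorter n (h + h').
Proof.
move=> [a ->] [b ->]; exists (fun y => a y + b y); rewrite -big_split /=.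
by apply: eq_bigr => y _; rewrite scalerDl.
Qed.

Lemma shorterZ n c h : shorter n h -> shorter n (c *: h).
Proof.
move=> [a ->]; exists (fun y => c * a y); rewrite scaler_sumr.
by apply: eq_bigr => y _; rewrite scalerA.
Qed.

Lemma shorterT n y : (len y < n)%N -> shorter n (T y).
Proof.
move=> yn; exists (fun z => (z == y)%:R); rewrite (bigD1 y) //= eqxx scale1r.
by rewrite big1 ?addr0 // => z /andP[_ /negPf ->]; rewrite scale0r.
Qed.

Lemma shorterS n h i : shorter n h -> shorter n.+1 (Ts i * h).
Proof.
move=> [a ->]; rewrite mulr_sumr; elim/big_ind: _ => [||y yn].
- by exists (fun=> 0); rewrite big1 // => y _; rewrite scale0r.
- exact: shorterD.
rewrite -scalerAr; apply: shorterZ; rewrite T_mull_simple.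
have le : (len (simple i * y)%g < n.+1)%N.
  by have := len_mull_simple y i; move: yn; lia.
have [_|_] := ifP; first exact: shorterT.
by apply: shorterD; [apply/shorterZ/shorterT; lia | apply: shorterT].
Qed.

Lemma shorterW n p h : (n <= p)%N -> shorter n h -> shorter p h.
Proof.
move=> np [a ->]; elim/big_ind: _ => [||y yn].
- by exists (fun=> 0); rewrite big1 // => y _; rewrite scale0r.
- exact: shorterD.
by apply/shorterZ/shorterT; apply: leq_trans yn np.
Qed.

Variable barH : H -> H.
Hypothesis hbarH : is_hecke_bar T barH.

Lemma barHD h h' : barH (h + h') = barH h + barH h'.
Proof. exact: (hecke_bar_semilinear hbarH).1. Qed.

Lemma barHZ a h : barH (a *: h) = bar a *: barH h.
Proof. exact: (hecke_bar_semilinear hbarH).2. Qed.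

Lemma barH0 : barH 0 = 0.
Proof. by rewrite -(scale0r 1) barHZ barr0 !scale0r. Qed.

Lemma barH_T_unique w h : T w^-1%g * h = 1 -> barH (T w) = h.
Proof. by move=> e; rewrite -[barH _]mulr1 -e mulrA (hecke_barT hbarH w).1 mul1r. Qed.

Lemma barH1 : barH 1 = 1.
Proof. by rewrite -T1; apply: barH_T_unique; rewrite invg1 T1 mulr1. Qed.

Lemma barH_Ts i : barH (Ts i) = Ts i - (u - uV)%:A.
Proof.
by apply: barH_T_unique; rewrite simpleV mulrBr Ts_sqr -scalerAr mulr1 addrC addKr.
Qed.

Lemma barH_T_mul x y : len (x * y)%g = (len x + len y)%N ->
  barH (T (x * y)%g) = barH (T x) * barH (T y).
Proof.
move=> e; apply: barH_T_unique.
have <- : T y^-1%g * T x^-1%g = T (x * y)^-1%g.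
  by rewrite (hecke_mul hH) -invMg // !lenV e addnC.
by rewrite -mulrA [_ * (_ * barH _)]mulrA (hecke_barT hbarH x).2 mul1r (hecke_barT hbarH y).2.
Qed.

(** [is_hecke_bar] says nothing about products; they are needed with a right factor T_s, hence with
    C'_s. When ys is shorter than y, the claim comes from the quadratic relation for bar T_s, as bar
    negates u - u^-1. *)
Lemma barH_mul_Ts h i : barH (h * Ts i) = barH h * barH (Ts i).
Proof.
elim/hecke_ind: h => [|h h' IH IH'|a y].
- by rewrite mul0r barH0 mul0r.
- by rewrite mulrDl !barHD mulrDl IH IH'.
rewrite -scalerAl !barHZ -scalerAl; congr (_ *: _).
have [up|down] := len_mulr_simple y i.
  by rewrite T_mulr_simple up ltnS leqnn barH_T_mul // up len_simple addn1.
have ey : y = (y * simple i * simple i)%g by rewrite -mulgA simpleK mulg1.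
rewrite T_mulr_simple ltnNge down leqnSn /= barHD barHZ.
have e : barH (T y) = barH (T (y * simple i)%g) * barH (Ts i).
  by rewrite [in LHS]ey barH_T_mul -?ey // len_simple addn1.
rewrite e -mulrA.
have -> : barH (Ts i) * barH (Ts i) = bar (u - uV) *: barH (Ts i) + 1.
  have -> : bar (u - uV) = - (u - uV).
    by rewrite barrD barrN bar_u bar_uV opprB addrC.
  rewrite {2}barH_Ts mulrBr -scalerAr mulr1 scaleNr addrC; congr (_ + _).
  by rewrite barH_Ts mulrBl Ts_sqr -scalerAl mul1r addrC addKr.
by rewrite mulrDr mulr1 -scalerAr.
Qed.

Lemma barH_mul_Cprime h i : barH (h * Cprime T i) = barH h * Cprime T i.
Proof.
rewrite /Cprime mulrDr barHD barH_mul_Ts barH_Ts -scalerAr mulr1 barHZ bar_uV.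
rewrite mulrBr mulrDr -!scalerAr !mulr1 scalerBl -addrA; congr (_ + _).
by rewrite opprB subrK.
Qed.

(** If sy is longer than y, then bar T_sy is the product of T_s - (u - u^-1) and bar T_y, and left
    multiplication by T_s raises the filtration by at most 1. *)
Lemma barH_T_shorter x : shorter (len x) (barH (T x) - T x).
Proof.
have [t <- st] := len_wordP x; rewrite -st; elim: t {x} st => [|i t IH] st.
  rewrite /word big_nil T1 barH1 subrr; exists (fun=> 0).
  by rewrite big1 // => y _; rewrite scale0r.
move: st; rewrite word_cons /= => st; have le := len_word_le t.
have [up|down] := len_mull_simple (word t) i; last first.
  by move: le; rewrite down -st ltnNge ltnW.
have {}st : size t = len (word t) by move: st; rewrite up => -[].
have ladd : len (simple i * word t)%g = (len (simple i) + len (word t))%N.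
  by rewrite up len_simple add1n.
rewrite barH_T_mul // -(hecke_mul hH) // barH_Ts; move: (IH st); set l := _ - _ => hl.
have -> : barH (T (word t)) = l + T (word t) by rewrite subrK.
rewrite mulrBl mulrDr addrAC addrK -scalerAl mul1r -scaleNr.
apply: shorterD; first exact: shorterS.
apply/shorterZ/shorterD; last by apply: shorterT; rewrite st.
exact: shorterW hl.
Qed.

End HeckeAlgebra.

(** * Induced modules *)

Section AdditiveMap.

Variables (U V : zmodType) (f : U -> V).
Hypothesis fD : {morph f : x y / x + y}.

(* The proof argument is a tag from which unification finds the additive structure. *)
Definition additive_map & {morph f : x y / x + y} : U -> V := f.

Lemma additive_map_subproof : zmod_morphism (additive_map fD).
Proof.
have f0 : f 0 = 0 by apply: (addrI (f 0)); rewrite -fD !addr0.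
have fN x : f (- x) = - f x by apply/eqP; rewrite -subr_eq0 opprK -fD addNr f0.
by move=> x y; rewrite /additive_map fD fN.
Qed.

HB.instance Definition _ :=
  GRing.isZmodMorphism.Build U V (additive_map fD) additive_map_subproof.

Definition additive_of : {additive U -> V} := additive_map fD.

Lemma additive_ofE x : additive_of x = f x.
Proof. by []. Qed.

End AdditiveMap.

Section Scal.

Variables (H : algType laurent) (M : lmodType H).
Implicit Types (a b : laurent) (h : H) (z : M).

Lemma scal_comm a h z : h *: scal a z = scal a (h *: z).
Proof. by rewrite /scal !scalerA -scalerAl mul1r -scalerAr mulr1. Qed.

Lemma scaler_scal a h z : (a *: h) *: z = scal a (h *: z).
Proof. by rewrite /scal scalerA -scalerAl mul1r. Qed.

Lemma scal_int (n : int) z : scal n%:~R z = z *~ n.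
Proof. by rewrite /scal !scaler_int. Qed.

End Scal.

Section TensorProduct.

Variables (m : nat) (H : algType laurent) (T : 'S_m.+1 -> H) (K : {set 'I_m}).
Variables (E M : lmodType H) (t : H -> E -> M).
Hypotheses (hH : is_hecke T) (ht : is_tensor T K t).
Implicit Types (x y k : 'S_m.+1) (h : H) (e : E) (z : M) (a : laurent).

Local Notation hb := (hecke_basis hH).
Local Notation hsc := (lmod_scaling H).

Lemma tensorDl h h' e : t (h + h') e = t h e + t h' e.
Proof. by case: (tensor_balanced ht) => tD _ _; apply: tD. Qed.

Lemma tensorDr h e e' : t h (e + e') = t h e + t h e'.
Proof. by case: (tensor_balanced ht) => _ tD _; apply: tD. Qed.

Lemma tensor_mull h (k : H) e : hecke_par T K k -> t (h * k) e = t h (k *: e).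
Proof. by case: (tensor_balanced ht) => _ _ tM; apply: tM. Qed.

Lemma tensor_mulT h k e : k \in parabolic K -> t (h * T k) e = t h (T k *: e).
Proof. by move=> kK; apply/tensor_mull/hecke_par_T. Qed.

Lemma tensorZl a h e : t (a *: h) e = scal a (t h e).
Proof. by rewrite /scal (tensor_action ht) -scalerAl mul1r. Qed.

Lemma tensorZr a h e : t h (scal a e) = scal a (t h e).
Proof.
rewrite -tensorZl /scal -tensor_mull; last exact: hecke_par_scalar.
by rewrite -scalerAr mulr1.
Qed.

Lemma tensor0r h : t h 0 = 0.
Proof. by apply: (addrI (t h 0)); rewrite -tensorDr !addr0. Qed.

Lemma tensor_ext (N : zmodType) (g g' : {additive M -> N}) :
  (forall h e, g (t h e) = g' (t h e)) -> g =1 g'.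
Proof.
move=> e; have [|g0 _ uniq] := tensor_universal ht (f := fun h e => g (t h e)).
  split=> [h h' x|h x x'|h k x kK]; first by rewrite tensorDl raddfD.
    by rewrite tensorDr raddfD.
  by rewrite tensor_mull.
by move=> z; rewrite (uniq g) // (uniq g').
Qed.

(* The H_K-linear projection of H = \bigoplus_x T_x H_K onto the summand of x
   in W^K, applied to e. *)
Definition tensor_coef x h e : E :=
  if x \in minreps K then \sum_(k in parabolic K) scal (crd hb h (x * k)%g) (T k *: e) else 0.

Lemma tensor_coefDl x h h' e :
  tensor_coef x (h + h') e = tensor_coef x h e + tensor_coef x h' e.
Proof.
rewrite /tensor_coef; case: ifP => _; last by rewrite addr0.
rewrite -big_split; apply: eq_bigr => k _ /=.
by rewrite (crdD hsc) (scalingDl (scal_scaling E)).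
Qed.

Lemma tensor_coefDr x h e e' :
  tensor_coef x h (e + e') = tensor_coef x h e + tensor_coef x h e'.
Proof.
rewrite /tensor_coef; case: ifP => _; last by rewrite addr0.
rewrite -big_split; apply: eq_bigr => k _ /=.
by rewrite scalerDr (scalingDr (scal_scaling E)).
Qed.

Lemma tensor_coefZl x a h e : tensor_coef x (a *: h) e = scal a (tensor_coef x h e).
Proof.
rewrite /tensor_coef; case: ifP => _; last by rewrite (scaling0r (scal_scaling E)).
rewrite (scaling_sumr (scal_scaling E)); apply: eq_bigr => k _ /=.
by rewrite (crdZ hsc) (scalingA (scal_scaling E)).
Qed.

Lemma tensor_coefZr x a h e : tensor_coef x h (scal a e) = scal a (tensor_coef x h e).
Proof.
rewrite /tensor_coef; case: ifP => _; last by rewrite (scaling0r (scal_scaling E)).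
rewrite (scaling_sumr (scal_scaling E)); apply: eq_bigr => k _ /=.
by rewrite scal_comm -!(scalingA (scal_scaling E)) mulrC.
Qed.

Lemma tensor_coefT x y e : x \in minreps K -> tensor_coef x (T y) e =
  if (x^-1 * y)%g \in parabolic K then T (x^-1 * y)%g *: e else 0.
Proof.
move=> xK; rewrite /tensor_coef xK.
have cE k : crd hb (T y) (x * k)%g = (k == (x^-1 * y)%g)%:R.
  by rewrite (crd_basis hsc) -(inj_eq (mulgI x) k) mulKVg eq_sym.
under eq_bigr do rewrite cE.
case: ifPn => xy; last first.
  rewrite big1 // => k kK; case: eqP => [e'|_]; first by rewrite -e' kK in xy.
  exact: (scaling0l (scal_scaling E)).
rewrite (bigD1 (x^-1 * y)%g) //= eqxx (scaling1 (scal_scaling E)) big1 ?addr0 //.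
move=> k /andP[_ /negPf ->]; exact: (scaling0l (scal_scaling E)).
Qed.

(** It suffices to move one T_s with s in K. For y = xk with k in W_K the lengths of y and ys exceed
    those of k and ks by l(x), so T_y T_s and T_k T_s fall under the same case of the multiplication
    rule. If y is outside x W_K, so is ys. *)
Lemma tensor_coef_balanced x : balanced T K (tensor_coef x).
Proof.
split=> [h h' e|h e e'|h k e kK]; [exact: tensor_coefDl | exact: tensor_coefDr |].
move: k kK h e; apply: (hecke_par_ind hH) => [h e|k k' IH IH' h e|k k' IH IH' h e|a k IH h e|i iK h e].
- by rewrite mulr1 scale1r.
- by rewrite mulrDr tensor_coefDl IH IH' scalerDl tensor_coefDr.
- by rewrite mulrA IH' IH scalerA.
- by rewrite -scalerAr tensor_coefZl IH scaler_scal tensor_coefZr.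
elim/(hecke_ind hH): h => [|h h' IH IH'|a y].
- by rewrite mul0r -(scale0r 1) !tensor_coefZl !(scaling0l (scal_scaling E)).
- by rewrite mulrDl !tensor_coefDl IH IH'.
rewrite -scalerAl !tensor_coefZl; congr (scal _ _).
have [xK|xNK] := boolP (x \in minreps K); last by rewrite /tensor_coef (negPf xNK).
have sK := parabolic_simple iK.
have ysE : (x^-1 * (y * simple i))%g = (x^-1 * y * simple i)%g by rewrite mulgA.
rewrite (T_mulr_simple hH).
have [xy|xy] := boolP ((x^-1 * y)%g \in parabolic K); last first.
  have xys : (x^-1 * (y * simple i))%g \notin parabolic K by rewrite ysE groupMr.
  have c0 e' (z : 'S_m.+1) : (x^-1 * z)%g \notin parabolic K -> tensor_coef x (T z) e' = 0.
    by move=> /negPf xz; rewrite tensor_coefT // xz.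
  case: ifP => _; rewrite ?tensor_coefDl ?tensor_coefZl !c0 //.
  by rewrite (scaling0r (scal_scaling E)) addr0.
have xys : (x^-1 * y * simple i)%g \in parabolic K by rewrite groupMr.
rewrite [RHS]tensor_coefT // xy scalerA (T_mulr_simple hH).
have ly : len y = (len x + len (x^-1 * y)%g)%N by rewrite -(len_minreps_mul xK xy) mulKVg.
have lys : len (y * simple i)%g = (len x + len (x^-1 * y * simple i)%g)%N.
  by rewrite -(len_minreps_mul xK xys) -ysE mulKVg.
rewrite ly lys ltn_add2l; case: ifP => _; rewrite ?tensor_coefDl ?tensor_coefZl !tensor_coefT //.
  by rewrite ysE xys.
by rewrite ysE xys xy scalerDl scaler_scal.
Qed.

(** The component z_x of z = sum_x T_x [x] z_x; it is the zero map for x outside W^K. *)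
Definition tcrd x : {additive M -> E} :=
  sval (cid2 (tensor_universal ht (tensor_coef_balanced x))).

Lemma tcrdt x h e : tcrd x (t h e) = tensor_coef x h e.
Proof. by rewrite /tcrd; case: cid2. Qed.

Lemma tcrdT x y e : x \in minreps K -> tcrd x (t (T y) e) =
  if (x^-1 * y)%g \in parabolic K then T (x^-1 * y)%g *: e else 0.
Proof. by move=> xK; rewrite tcrdt tensor_coefT. Qed.

Lemma tcrdE z : z = \sum_(x in minreps K) t (T x) (tcrd x z).
Proof.
pose g z := \sum_(x in minreps K) t (T x) (tcrd x z).
have gD : {morph g : z z' / z + z'}.
  move=> z1 z2; rewrite -big_split; apply: eq_bigr => x _ /=.
  by rewrite raddfD tensorDr.
have gZ a h e : g (t (a *: h) e) = scal a (g (t h e)).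
  rewrite (scaling_sumr (scal_scaling M)); apply: eq_bigr => x _.
  by rewrite !tcrdt tensor_coefZl tensorZr.
suff gt h e : additive_of gD (t h e) = t h e.
  by rewrite -[RHS](tensor_ext (g := idfun) (g' := additive_of gD)).
rewrite additive_ofE; elim/(hecke_ind hH): h => [|h h' IH IH'|a y].
- by rewrite -(scale0r 1) gZ tensorZl !(scaling0l (scal_scaling M)).
- by rewrite !tensorDl gD IH IH'.
rewrite gZ tensorZl; congr (scal _ _).
(* With y = xk and l(y) = l(x) + l(k), the tensor T_y [x] e equals T_x [x] T_k e, so x carries its
   only component. *)
have [x xK xy] := minreps_exists K y.
rewrite /g (bigD1 x) //= big1 => [|x' /andP[x'K ne]]; last first.
  rewrite tcrdT //; case: ifP => [x'y|]; last by rewrite tensor0r.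
  case/eqP: ne; apply: minreps_inj x'K xK _.
  by rewrite -[x](mulKVg y) mulgA groupM // -groupV invMg invgK.
rewrite addr0 tcrdT // xy -tensor_mulT // (hecke_mul hH) ?mulKVg //.
by rewrite -(len_minreps_mul xK xy) mulKVg.
Qed.

Lemma tcrd_lincomb x (F : 'S_m.+1 -> E) : x \in minreps K ->
  tcrd x (\sum_(y in minreps K) t (T y) (F y)) = F x.
Proof.
move=> xK; rewrite raddf_sum (bigD1 x) //= big1 => [|y /andP[yK ne]]; last first.
  by rewrite tcrdT // mem_minrepsV // eq_sym (negPf ne).
by rewrite addr0 tcrdT // mem_minrepsV // eqxx mulVg T1 // scale1r.
Qed.

Lemma tcrdZ x a z : x \in minreps K -> tcrd x (scal a z) = scal a (tcrd x z).
Proof.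
move=> xK; rewrite {1}(tcrdE z) (scaling_sumr (scal_scaling M)).
by under eq_bigr do rewrite -tensorZr; rewrite tcrd_lincomb.
Qed.

End TensorProduct.

(** * Canonical bases *)

Section WgraphModule.

Variables (m : nat) (H : algType laurent) (T : 'S_m.+1 -> H).
Variables (Gamma : choiceType) (mu : Gamma -> Gamma -> int) (L : Gamma -> {set 'I_m}).
Variables (E : lmodType H) (v : Gamma -> E) (barE : E -> E).
Hypotheses (hE : is_Wgraph T mu L v) (hbarE : is_Wgraph_bar v barE).
Implicit Types (a : laurent) (e : E) (g d : Gamma) (i : 'I_m).

Local Notation eb := (wgraph_basis hE).
Local Notation esc := (scal_scaling E).

Lemma barED e e' : barE (e + e') = barE e + barE e'.
Proof. exact: (wgraph_bar_semilinear hbarE).1. Qed.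

Lemma barEZ a e : barE (scal a e) = scal (bar a) (barE e).
Proof. exact: (wgraph_bar_semilinear hbarE).2. Qed.

Lemma barE0 : barE 0 = 0.
Proof. by apply: (addrI (barE 0)); rewrite -barED !addr0. Qed.

Lemma barE_sum (J : Type) (r : seq J) (F : J -> E) :
  barE (\sum_(j <- r) F j) = \sum_(j <- r) barE (F j).
Proof. exact: (big_morph _ barED barE0). Qed.

Lemma crd_barE e g : crd eb (barE e) g = bar (crd eb e g).
Proof.
elim/(basis_ind eb): e => [|e e' IH IH'|a d].
- by rewrite barE0 (crd0 esc) barr0.
- by rewrite barED !(crdD esc) IH IH' barrD.
rewrite barEZ (wgraph_bar_fix hbarE) !(crdZ esc) (crd_basis esc) barrM.
by case: (d == g); rewrite ?(bar_int 1) // (barr0).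
Qed.

Lemma barE_Cprime i e : barE (Cprime T i *: e) = Cprime T i *: barE e.
Proof.
elim/(basis_ind eb): e => [|e e' IH IH'|a g].
- by rewrite barE0 scaler0 barE0.
- by rewrite barED !scalerDr barED IH IH'.
rewrite scal_comm !barEZ (wgraph_bar_fix hbarE) scal_comm; congr (scal _ _).
have [iL|iL] := boolP (i \in L g).
  by rewrite (wgraph_in hE iL) barEZ bar_two (wgraph_bar_fix hbarE).
have [D _ ->] := wgraph_out hE iL; rewrite barE_sum; apply: eq_bigr => d _.
by rewrite -!scal_int barEZ bar_int (wgraph_bar_fix hbarE).
Qed.

Lemma crd_Cprime_int i g d : i \notin L g -> exists n : int, crd eb (Cprime T i *: v g) d = n%:~R.
Proof.
move=> iL; have [D _ ->] := wgraph_out hE iL.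
exists (\sum_(d' <- D) mu d' g * (d' == d)%:R).
rewrite (crd_sum esc) rmorph_sum; apply: eq_bigr => d' _ /=.
by rewrite -scal_int (crdZ esc) (crd_basis esc) rmorphM /=; case: eqP.
Qed.

(** Both W-graph rules for C'_i produce only basis elements whose descent set contains i. *)
Lemma crd_Cprime_out i e d : i \notin L d -> crd eb (Cprime T i *: e) d = 0.
Proof.
move=> iLd; elim/(basis_ind eb): e => [|e e' IH IH'|a g].
- by rewrite scaler0 (crd0 esc).
- by rewrite scalerDr (crdD esc) IH IH' addr0.
rewrite scal_comm (crdZ esc).
have [iL|iL] := boolP (i \in L g).
  rewrite (wgraph_in hE iL) (crdZ esc) (crd_basis esc); case: eqP => [gd|_]; last by rewrite !mulr0.
  by rewrite gd (negPf iLd) in iL.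
have [D DE ->] := wgraph_out hE iL; rewrite (crd_sum esc) big_seq big1 ?mulr0 // => d' d'D.
rewrite -scal_int (crdZ esc) (crd_basis esc); case: eqP => [dd|_]; last by rewrite mulr0.
by move: d'D; rewrite DE dd (negPf iLd).
Qed.

(** The factor [2], which contains u, arises only at g with i in L(g), where a factor u^-1 is
    available; all other matrix entries of C'_i are integers. *)
Lemma crd_Cprime_Aminus i e d : (forall g, Aminus (crd eb e g)) ->
  (forall g, i \in L g -> uV_Aminus (crd eb e g)) -> Aminus (crd eb (Cprime T i *: e) d).
Proof.
move=> eA eU; rewrite {1}(crdE eb e) scaler_sumr (crd_sum esc); apply: Aminus_sum => g _.
rewrite scal_comm (crdZ esc); have [iL|iL] := boolP (i \in L g).
  rewrite (wgraph_in hE iL) (crdZ esc) (crd_basis esc) mulrCA.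
  by apply: Aminus_two_mul; rewrite mulrC; apply: uV_AminusM (eU _ iL); apply: (Aminus_int (g == d)).
by have [n ->] := crd_Cprime_int d iL; apply: AminusM => //; apply: Aminus_int.
Qed.

End WgraphModule.

Section CanonicalBasis.

Variables (m : nat) (H : algType laurent) (T : 'S_m.+1 -> H) (barH : H -> H).
Hypotheses (hH : is_hecke T) (hbarH : is_hecke_bar T barH).
Variables (Gamma : choiceType) (mu : Gamma -> Gamma -> int) (L : Gamma -> {set 'I_m}).
Variables (E : lmodType H) (v : Gamma -> E) (barE : E -> E).
Hypotheses (hE : is_Wgraph T mu L v) (hbarE : is_Wgraph_bar v barE).
Variables (K : {set 'I_m}) (M : lmodType H) (t : H -> E -> M) (barM : M -> M).
Hypotheses (ht : is_tensor T K t) (hbarM : is_tensor_bar barH barE t barM).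
Variable C : 'S_m.+1 -> Gamma -> M.
Hypothesis hC : is_canonical_basis T K v t barM C.
Implicit Types (x y w : 'S_m.+1) (a : laurent) (e : E) (z : M) (g d : Gamma).

Local Notation eb := (wgraph_basis hE).
Local Notation esc := (scal_scaling E).
Local Notation tcrd := (tcrd hH ht).

Lemma barMD z z' : barM (z + z') = barM z + barM z'.
Proof. exact: (tensor_bar_semilinear hbarM).1. Qed.

Lemma barMZ a z : barM (scal a z) = scal (bar a) (barM z).
Proof. exact: (tensor_bar_semilinear hbarM).2. Qed.

Lemma barM0 : barM 0 = 0.
Proof. by apply: (addrI (barM 0)); rewrite -barMD !addr0. Qed.

Lemma barMN z : barM (- z) = - barM z.
Proof. by apply/eqP; rewrite -subr_eq0 opprK -barMD addNr barM0. Qed.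

Lemma barM_sum (J : Type) (r : seq J) (P : pred J) (F : J -> M) :
  barM (\sum_(j <- r | P j) F j) = \sum_(j <- r | P j) barM (F j).
Proof. exact: (big_morph _ barMD barM0). Qed.

(* bar (T_y [x] e) = T_y [x] bar e up to terms of smaller length, so the
   components of maximal length of a bar-invariant element are bar-invariant. *)
Lemma bar_fixed_component z : barM z = z -> z <> 0 ->
  exists x, [/\ x \in minreps K, tcrd x z != 0 & barE (tcrd x z) = tcrd x z].
Proof.
move=> bz z0.
have [x0 /andP[x0K x0z]] : exists x, (x \in minreps K) && (tcrd x z != 0).
  apply/existsP; apply: contra_notT z0 => /existsPn h.
  rewrite (tcrdE hH ht z) big1 // => x xK.
  by move: (h x); rewrite xK /= negbK => /eqP ->; apply: (tensor0r ht).
have Px0 : (x0 \in minreps K) && (tcrd x0 z != 0) by rewrite x0K.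
case: (arg_maxnP (@len m) (P := fun x => (x \in minreps K) && (tcrd x z != 0)) Px0).
move=> x /andP[xK xz] maxx; exists x; split=> //.
have key y : y \in minreps K ->
    tcrd x (barM (t (T y) (tcrd y z))) = if y == x then barE (tcrd x z) else 0.
  move=> yK; rewrite (tensor_barE hbarM).
  have [l0|l0] := eqVneq (tcrd y z) 0.
    rewrite l0 (barE0 hbarE) (tensor0r ht) raddf0; case: eqP => // yx.
    by rewrite -yx l0 (barE0 hbarE).
  have lyx : (len y <= len x)%N by apply: maxx; rewrite yK.
  have [c ec] := barH_T_shorter hH hbarH y.
  rewrite -[barH _](subrK (T y)) ec (tensorDl ht) raddfD /= addrC.
  have -> : tcrd x (t (T y) (barE (tcrd y z))) = if y == x then barE (tcrd x z) else 0.
    rewrite tcrdT // mem_minrepsV // eq_sym; case: eqP => // ->.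
    by rewrite mulVg (T1 hH) scale1r.
  rewrite tcrdt; set e := barE (tcrd y z).
  suff -> : tensor_coef K hH x (\sum_(w | (len w < len y)%N) c w *: T w) e = 0.
    by rewrite addr0.
  elim/big_ind: _ => [|h h' IH IH'|w lw].
  - by rewrite -(scale0r 1) tensor_coefZl (scaling0l esc).
  - by rewrite tensor_coefDl IH IH' addr0.
  rewrite tensor_coefZl tensor_coefT //; case: ifP => [xw|_]; last exact: (scaling0r esc).
  by have := minreps_min xK xw; rewrite leqNgt (leq_trans lw lyx).
rewrite -[in RHS]bz {2}(tcrdE hH ht z) barM_sum raddf_sum /=.
rewrite (bigD1 x) //= key // eqxx big1 ?addr0 // => y /andP[yK /negPf ne].
by rewrite key // ne.
Qed.

(** The uniqueness argument of Kazhdan and Lusztig: a nonzero z would have a nonzero bar-fixed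
    component, with bar-fixed coefficients in u^-1 Z[u^-1]. *)
Lemma bar_fixed_eq0 z : barM z = z ->
  (forall x d, x \in minreps K -> uV_Aminus (crd eb (tcrd x z) d)) -> z = 0.
Proof.
move=> bz hz; apply: contrapT => z0.
have [x [xK xz bx]] := bar_fixed_component bz z0.
case/eqP: xz; apply: (crd_inj (bP := eb)) => d; rewrite (crd0 esc).
apply: uV_Aminus_bar0; first exact: hz.
by rewrite -(crd_barE hE hbarE) bx.
Qed.

Lemma crd_canonical w g x d : w \in minreps K -> x \in minreps K ->
  uV_Aminus (crd eb (tcrd x (C w g)) d - ((x == w) && (g == d))%:R).
Proof.
move=> wK xK; have [f fU ->] := canonical_congr hC g wK.
rewrite raddfD (crdD esc) addrAC.
have -> : crd eb (tcrd x (t (T w) (v g))) d = ((x == w) && (g == d))%:R.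
  rewrite tcrdT // mem_minrepsV //; case: eqP => [->|_]; last by rewrite (crd0 esc).
  by rewrite mulVg (T1 hH) scale1r (crd_basis esc).
rewrite subrr add0r raddf_sum (crd_sum esc); apply: uV_Aminus_sum => -[[y yK] d'] _ /=.
rewrite (tcrdZ hH ht) // (crdZ esc) /family_on /= tcrdT // mem_minrepsV //.
rewrite mulrC; apply: uV_AminusM => //; case: eqP => [->|_].
  by rewrite mulVg (T1 hH) scale1r (crd_basis esc); apply: (Aminus_int (d' == d)).
by rewrite (crd0 esc); apply: (Aminus_int 0).
Qed.

(** Subtracting the combination given by the constant terms leaves a bar-fixed element with
    coefficients in u^-1 A^-. The second clause serves to rule out indices. *)
Lemma canonical_expansion z : barM z = z ->
  (forall x d, x \in minreps K -> Aminus (crd eb (tcrd x z) d)) ->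
  exists (r : seq (canon_index K Gamma)) (N : canon_index K Gamma -> int),
    z = \sum_(i <- r) family_on C i *~ N i /\
    (forall i, uV_Aminus (crd eb (tcrd (val i.1) z) i.2) -> N i = 0).
Proof.
move=> bz hz.
(* Choosing 0 whenever the coefficient lies in u^-1 A^- gives the second clause without uniqueness
   of constant terms. *)
have /choice[N HN] : forall i : canon_index K Gamma, exists n : int,
    uV_Aminus (crd eb (tcrd (val i.1) z) i.2 - n%:~R) /\
    (uV_Aminus (crd eb (tcrd (val i.1) z) i.2) -> n = 0).
  move=> i; have [iU|iU] := pselect (uV_Aminus (crd eb (tcrd (val i.1) z) i.2)).
    by exists 0; rewrite mulr0z subr0.
  by have [n hn] := Aminus_constant (hz (val i.1) i.2 (valP i.1)); exists n.
pose r : seq (canon_index K Gamma) := undup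
  (flatten [seq [seq (x, d) | d <- finsupp (crd eb (tcrd (val x) z))] |
    x : {x : 'S_m.+1 | x \in minreps K}]).
have crd0r i : i \notin r -> crd eb (tcrd (val i.1) z) i.2 = 0.
  move=> ir; apply: fsfun_dflt; apply: contra ir => h.
  rewrite mem_undup; apply/flatten_mapP; exists i.1; first by rewrite mem_enum.
  by apply/mapP; exists i.2 => //; case: (i).
have famE i x : crd eb (tcrd x (family_on C i)) =1 crd eb (tcrd x (C (val i.1) i.2)) by [].
exists r, N; split=> [|i]; last exact: (HN i).2.
apply/eqP; rewrite -subr_eq0; apply/eqP/bar_fixed_eq0.
  rewrite barMD barMN barM_sum bz; congr (_ - _); apply: eq_bigr => i _.
  by rewrite -scal_int barMZ bar_int /family_on (canonical_bar hC) ?(valP i.1).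
move=> x d xK; pose j : canon_index K Gamma := (Sub x xK, d).
have eN i : crd eb (tcrd x (family_on C i *~ N i)) d =
    (N i)%:~R * (crd eb (tcrd x (family_on C i)) d - (i == j)%:R) + (N i)%:~R * (i == j)%:R.
  by rewrite -scal_int (tcrdZ hH ht) // (crdZ esc) -mulrDr subrK.
rewrite raddfB (crdB esc) raddf_sum (crd_sum esc).
under eq_bigr do rewrite eN.
rewrite big_split /= opprD addrCA; apply: uV_AminusD.
  apply/uV_AminusN/uV_Aminus_sum => i _; apply: uV_AminusM; first exact: Aminus_int.
  have -> : (i == j) = (x == val i.1) && (i.2 == d).
    by case: (i) => i1 d'; rewrite /j xpair_eqE -val_eqE /= eq_sym.
  exact: crd_canonical (valP i.1) xK.
have [jr|jr] := boolP (j \in r); last first.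
  rewrite (crd0r j jr) big_seq big1 ?subrr; last first.
    by move=> i ir; case: eqP => [ij|_]; [rewrite -ij ir in jr | rewrite mulr0].
  exact: uV_Aminus0.
rewrite (bigD1_seq j) ?undup_uniq //= eqxx mulr1 big1 ?addr0; last first.
  by move=> i /negPf ->; rewrite mulr0.
exact: (HN j).1.
Qed.

End CanonicalBasis.

(** * Bar-equivariant maps between induced modules *)

Section EquivariantMap.

Variables (m : nat) (H : algType laurent) (T : 'S_m.+1 -> H) (barH : H -> H).
Hypotheses (hH : is_hecke T) (hbarH : is_hecke_bar T barH).
Variables (E : lmodType H) (barE : E -> E).
Variables (K : {set 'I_m}) (M : lmodType H) (t : H -> E -> M) (barM : M -> M).
Hypotheses (ht : is_tensor T K t) (hbarM : is_tensor_bar barH barE t barM).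
Variables (K' : {set 'I_m}) (M' : lmodType H) (t' : H -> E -> M') (barM' : M' -> M').
Hypotheses (ht' : is_tensor T K' t') (hbarM' : is_tensor_bar barH barE t' barM').
Variables a b : H.
Hypothesis ab_balanced : forall i h e, i \in K ->
  t' (h * T (simple i) * a) (b *: e) = t' (h * a) (b *: (T (simple i) *: e)).
Hypothesis barH_a : forall h, barH (h * a) = barH h * a.
Hypothesis barE_b : forall e, barE (b *: e) = b *: barE e.

(** Used twice: with a = 1 and b = C' - [2] it gives an endomorphism that detects eigenvectors, with
    a = b = C' the passage from K to J. *)
Lemma equivariant_map : exists2 g : {additive M -> M'},
  (forall h e, g (t h e) = t' (h * a) (b *: e)) & (forall z, barM' (g z) = g (barM z)).
Proof.
have [|g gt _] := tensor_universal ht (f := fun h e => t' (h * a) (b *: e)).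
  split=> [h h' e|h e e'|h k e kK]; first by rewrite mulrDl (tensorDl ht').
    by rewrite scalerDr (tensorDr ht').
  move: k kK h e; apply: (hecke_par_ind hH) => [h e|k k' IH IH' h e|k k' IH IH' h e|c k IH h e|i iK h e].
  - by rewrite mulr1 scale1r.
  - by rewrite mulrDr mulrDl (tensorDl ht') IH IH' scalerDl scalerDr (tensorDr ht').
  - by rewrite mulrA IH' IH scalerA.
  - by rewrite -scalerAr -scalerAl (tensorZl ht') IH scaler_scal scal_comm (tensorZr hH ht').
  exact: ab_balanced.
exists g => // z; rewrite {2}(tcrdE hH ht z) {1}(tcrdE hH ht z).
rewrite raddf_sum (barM_sum hbarM) (barM_sum hbarM') raddf_sum; apply: eq_bigr => x _ /=.
by rewrite gt (tensor_barE hbarM) (tensor_barE hbarM') gt barH_a barE_b.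
Qed.

End EquivariantMap.

(** * The [2]-eigenspace of C'_i *)

Section Eigenvectors.

Variables (m : nat) (H : algType laurent) (T : 'S_m.+1 -> H) (barH : H -> H).
Hypotheses (hH : is_hecke T) (hbarH : is_hecke_bar T barH).
Variables (Gamma : choiceType) (mu : Gamma -> Gamma -> int) (L : Gamma -> {set 'I_m}).
Variables (E : lmodType H) (v : Gamma -> E) (barE : E -> E).
Hypotheses (hE : is_Wgraph T mu L v) (hbarE : is_Wgraph_bar v barE).
Variables (K : {set 'I_m}) (M : lmodType H) (t : H -> E -> M) (barM : M -> M).
Hypotheses (ht : is_tensor T K t) (hbarM : is_tensor_bar barH barE t barM).
Variable C : 'S_m.+1 -> Gamma -> M.
Hypothesis hC : is_canonical_basis T K v t barM C.
Variable i : 'I_m.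
Hypothesis i_central : forall j, j \in K -> T (simple j) * Cprime T i = Cprime T i * T (simple j).

Local Notation eb := (wgraph_basis hE).
Local Notation esc := (scal_scaling E).
Local Notation tcrd := (tcrd hH ht).

(* The [2]-eigenspace of C'_i in A Gamma is the span of the g with i in L g;
   it is an H_K-submodule, and the canonical basis elements attached to these
   g lie in the induced submodule. *)
Lemma canonical_eigen w g x : w \in minreps K -> x \in minreps K -> i \in L g ->
  Cprime T i *: tcrd x (C w g) = scal two (tcrd x (C w g)).
Proof.
move=> wK xK ig; pose b := Cprime T i - two%:A.
have bE e : b *: e = Cprime T i *: e - scal two e by rewrite scalerBl.
have [|||q qt qbar] := equivariant_map hH ht hbarM ht hbarM (a := 1) (b := b).
- move=> j h e jK; rewrite !mulr1 (tensor_mulT ht) ?parabolic_simple // !bE.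
  rewrite scalerBr scal_comm !scalerA i_central //.
- by move=> h; rewrite !mulr1.
- move=> e; rewrite !bE (barED hbarE) (barE_Cprime hE hbarE); congr (_ + _).
  rewrite -!(scalingNl esc) (barEZ hbarE) barrN bar_two //.
have qx z y : y \in minreps K -> tcrd y (q z) = b *: tcrd y z.
  move=> yK; rewrite {1}(tcrdE hH ht z) raddf_sum /=.
  by under eq_bigr do rewrite qt mulr1; rewrite tcrd_lincomb.
suff q0 : q (C w g) = 0.
  by apply/eqP; rewrite -subr_eq0 -bE -qx // q0 raddf0.
apply: contrapT => qC0; have bqC : barM (q (C w g)) = q (C w g).
  by rewrite qbar (canonical_bar hC).
have [y [yK yn0 yb]] := bar_fixed_component hH hbarH hbarE ht hbarM bqC qC0.
case/eqP: yn0; rewrite qx // in yb *.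
have crd_b e d : i \notin L d -> crd eb (b *: e) d = - (two * crd eb e d).
  by move=> id; rewrite bE (crdB esc) crd_Cprime_out // sub0r (crdZ esc).
(* At such d the bar-fixed component of [q (C w g)] is -[2] times that of [C w g], and [2] is
   bar-fixed; so the latter coefficient is bar-fixed too, and it lies in u^-1 A^- because d differs
   from g. What remains of the component is killed by b. *)
have crd0d d : i \notin L d -> crd eb (tcrd y (C w g)) d = 0.
  move=> id; apply: uV_Aminus_bar0.
    have := crd_canonical hH hE ht hC g d wK yK.
    have -> : (g == d) = false by apply: contraNF id => /eqP <-.
    by rewrite andbF subr0.
  apply: (laurent_mulfI two_neq0); apply: oppr_inj.
  by rewrite -[two in LHS]bar_two -barrM -barrN -crd_b // -(crd_barE hE hbarE) yb.
rewrite {1}(crdE eb (tcrd y (C w g))) scaler_sumr big1 // => d _.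
rewrite scal_comm; have [id|id] := boolP (i \in L d); last first.
  by rewrite crd0d // (scaling0l esc).
by rewrite bE (wgraph_in hE id) subrr (scaling0r esc).
Qed.

End Eigenvectors.

(** * The projection from J' to S \ s_2 *)

Section Projection.

Variables (m : nat) (H : algType laurent) (T : 'S_m.+2 -> H) (barH : H -> H).
Hypotheses (hH : is_hecke T) (hbarH : is_hecke_bar T barH).
Variables (Gamma : choiceType) (mu : Gamma -> Gamma -> int) (L : Gamma -> {set 'I_m.+1}).
Variables (E : lmodType H) (v : Gamma -> E) (barE : E -> E).
Hypotheses (hE : is_Wgraph T mu L v) (hbarE : is_Wgraph_bar v barE).
Variables (MJ : lmodType H) (tJ : H -> E -> MJ) (barJ : MJ -> MJ).
Variable CJ : 'S_m.+2 -> Gamma -> MJ.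
Hypotheses (hJ : is_tensor T (Jprime m) tJ) (hbarJ : is_tensor_bar barH barE tJ barJ).
Hypothesis hCJ : is_canonical_basis T (Jprime m) v tJ barJ CJ.
Variables (MK : lmodType H) (tK : H -> E -> MK) (barK : MK -> MK).
Variable CK : 'S_m.+2 -> Gamma -> MK.
Hypotheses (hK : is_tensor T (S_minus_s2 m) tK) (hbarK : is_tensor_bar barH barE tK barK).
Hypothesis hCK : is_canonical_basis T (S_minus_s2 m) v tK barK CK.
Variable beta : {linear MJ -> MK}.
Hypothesis hbeta : forall h e, beta (tJ h e) = tK h e.
Implicit Types (w x y : 'S_m.+2) (e : E) (g d : Gamma).

Local Notation J := (Jprime m).
Local Notation K := (S_minus_s2 m).
Local Notation s := (ord0 : 'I_m.+1).
Local Notation Cs := (Cprime T s).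
Local Notation eb := (wgraph_basis hE).
Local Notation esc := (scal_scaling E).
Local Notation tcrdJ := (tcrd hH hJ).
Local Notation tcrdK := (tcrd hH hK).

Lemma T_commute (j : 'I_m.+1) : j \in J -> T (simple j) * T (simple s) = T (simple s) * T (simple j).
Proof.
move=> jJ; have c := simple_commute jJ.
have l2 : len (simple s * simple j)%g = 2.
  have [->|] := len_mulr_simple (simple s) j; first by rewrite len_simple.
  rewrite len_simple => -[/esym/eqP]; rewrite len_eq0 => /eqP e.
  have /negP[] := s0_Nparabolic m; rewrite -groupV -[_^-1%g]mulg1 -e mulKg.
  exact: parabolic_simple.
by rewrite (hecke_mul hH) -c ?(hecke_mul hH) // l2 !len_simple.
Qed.

(** Removing s_2 isolates s_1 in the Coxeter graph. *)
Lemma Cs_central (j : 'I_m.+1) : j \in K -> T (simple j) * Cs = Cs * T (simple j).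
Proof.
move=> jK; have [->|jJ] : j = s \/ j \in J.
    move: jK; rewrite !inE => j1; case: (posnP j) => j0; first by left; apply: val_inj.
    by right; lia.
  by rewrite (Ts_Cprime hH) (Cprime_Ts hH).
by rewrite /Cprime mulrDr mulrDl T_commute // -scalerAr -scalerAl mulr1 mul1r.
Qed.

(** The canonical basis shows that the module is free over the domain A. *)
Lemma scal_inj (c : laurent) (z z' : MJ) : c != 0 -> scal c z = scal c z' -> z = z'.
Proof.
have msc := scal_scaling MJ; have cb := canonical_basis hCJ.
move=> c0 e; apply: (crd_inj (bP := cb)) => i; apply: (laurent_mulfI c0).
by rewrite -!(crdZ msc) e.
Qed.

Lemma barK_beta z : barK (beta z) = beta (barJ z).
Proof.
rewrite {1}(tcrdE hH hJ z) {2}(tcrdE hH hJ z) raddf_sum (barM_sum hbarK) (barM_sum hbarJ) raddf_sum.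
apply: eq_bigr => x _ /=.
by rewrite hbeta (tensor_barE hbarK) (tensor_barE hbarJ) hbeta.
Qed.

Lemma tcrdJ_KT x w e : x \in minreps K -> w \in minreps K ->
  tcrdJ x (tJ (T w) e) = if x == w then e else 0.
Proof.
move=> xK wK; rewrite tcrdT ?mem_minrepsV ?minreps_KJ //.
by case: eqP => // ->; rewrite mulVg (T1 hH) scale1r.
Qed.

Lemma tcrdJ_sT x w e : x \in minreps K -> w \in minreps K ->
  tcrdJ (x * simple s)%g (tJ (T w) e) = 0.
Proof.
move=> xK wK; rewrite tcrdT ?minreps_KsJ // mem_minrepsV ?minreps_KsJ ?minreps_KJ //.
by case: eqP => // xw; have := minreps_KsNK xK; rewrite xw wK.
Qed.

Lemma tcrdJ_Ts x w e : x \in minreps K -> w \in minreps K ->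
  tcrdJ x (tJ (T (w * simple s)%g) e) = 0.
Proof.
move=> xK wK; rewrite tcrdT ?minreps_KJ // mem_minrepsV ?minreps_KsJ ?minreps_KJ //.
by case: eqP => // xw; have := minreps_KsNK wK; rewrite -xw xK.
Qed.

Lemma tcrdJ_sTs x w e : x \in minreps K -> w \in minreps K ->
  tcrdJ (x * simple s)%g (tJ (T (w * simple s)%g) e) = if x == w then e else 0.
Proof.
move=> xK wK; rewrite tcrdT ?mem_minrepsV ?minreps_KsJ // (inj_eq (mulIg _)).
by case: eqP => // ->; rewrite mulVg (T1 hH) scale1r.
Qed.

(** Over K the factor T_s may cross the tensor sign: T_xs [x] e becomes T_x [x] T_s e, which merges
    the components at x and xs. *)
Lemma tcrd_beta z x : x \in minreps K ->
  tcrdK x (beta z) = tcrdJ x z + T (simple s) *: tcrdJ (x * simple s)%g z.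
Proof.
have [F ->] : exists F : 'S_m.+2 -> E, z = \sum_(y in minreps J) tJ (T y) (F y).
  by exists (fun y => tcrdJ y z); apply: tcrdE.
move=> xK; rewrite !raddf_sum /= ?scaler_sumr -big_split /=.
apply: eq_bigr => y yJ; rewrite hbeta; move: (F y) => e.
have [yK|[w wK ->]] := minreps_JP yJ.
  rewrite tcrdJ_KT // tcrdJ_sT // scaler0 addr0 tcrdT // mem_minrepsV //.
  by case: eqP => // ->; rewrite mulVg (T1 hH) scale1r.
rewrite tcrdJ_Ts // tcrdJ_sTs // add0r tcrdT // mem_minrepsVs //.
by case: eqP => [->|_]; rewrite ?scaler0 // mulKg.
Qed.

(* [h [x] e |-> h C'_s [x] C'_s e] is well defined on H [x]_K A Gamma and
   bar-equivariant; it sends C~'_(w,g) to [2] times the element computed here,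
   which is then recognized as a canonical basis element. *)
Lemma canonical_J_s w g : w \in minreps K -> s \in L g ->
  CJ (w * simple s)%g g = \sum_(x in minreps K) tJ (T x * Cs) (tcrdK x (CK w g)).
Proof.
move=> wK sg; set z := \sum_(x in _) _.
have [|||th tht thbar] := equivariant_map hH hK hbarK hJ hbarJ (a := Cs) (b := Cs).
- move=> j h e jK; have [->|jJ] : j = s \/ j \in J.
      move: jK; rewrite !inE => j1; case: (posnP j) => j0; first by left; apply: val_inj.
      by right; lia.
    rewrite -mulrA (Ts_Cprime hH) scalerA (Cprime_Ts hH) -scalerAr scaler_scal.
    by rewrite (tensorZl hJ) (tensorZr hH hJ).
  rewrite -mulrA (Cs_central jK) mulrA (tensor_mulT hJ) ?parabolic_simple //.
  by rewrite !scalerA (Cs_central jK).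
- by move=> h; rewrite (barH_mul_Cprime hH hbarH).
- exact: (barE_Cprime hE hbarE).
have thC : th (CK w g) = scal two z.
  rewrite {1}(tcrdE hH hK (CK w g)) raddf_sum (scaling_sumr (scal_scaling MJ)).
  apply: eq_bigr => x xK; rewrite tht.
  by rewrite (canonical_eigen hH hbarH hE hbarE hK hbarK hCK Cs_central) // (tensorZr hH hJ).
(* Equivariance of [th] yields the invariance of [2] z, from which [2] is cancelled. *)
have bz : barJ z = z.
  apply: (scal_inj two_neq0); rewrite -[in LHS]bar_two -(barMZ hbarJ) -thC thbar.
  by rewrite (canonical_bar hCK).
(* The second summand carries u^-1 and the first reproduces the components of [CK w g], shifted by
   s; so z is congruent to T_ws [x] g modulo u^-1 A^-. *)
have TC x : x \in minreps K -> T x * Cs = T (x * simple s)%g + uV *: T x.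
  by move=> xK; rewrite /Cprime mulrDr (hecke_mul hH) ?len_mul_s0 ?len_simple ?addn1 // -scalerAr mulr1.
have zE : z = \sum_(x in minreps K) tJ (T (x * simple s)%g) (tcrdK x (CK w g)) +
    \sum_(x in minreps K) scal uV (tJ (T x) (tcrdK x (CK w g))).
  by rewrite -big_split; apply: eq_bigr => x xK /=; rewrite TC // (tensorDl hJ) (tensorZl hJ).
have zs x : x \in minreps K -> tcrdJ (x * simple s)%g z = tcrdK x (CK w g).
  move=> xK; rewrite zE raddfD !raddf_sum /= [X in _ + X]big1 ?addr0 => [|y yK]; last first.
    by rewrite (tcrdZ hH hJ) ?minreps_KsJ // tcrdJ_sT // (scaling0r esc).
  rewrite (bigD1 x) //= tcrdJ_sTs // eqxx big1 ?addr0 // => y /andP[yK ne].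
  by rewrite tcrdJ_sTs // eq_sym (negPf ne).
have zx x : x \in minreps K -> tcrdJ x z = scal uV (tcrdK x (CK w g)).
  move=> xK; rewrite zE raddfD !raddf_sum /= big1 ?add0r => [|y yK]; last first.
    by rewrite tcrdJ_Ts.
  rewrite (bigD1 x) //= (tcrdZ hH hJ) ?minreps_KJ // tcrdJ_KT // eqxx big1 ?addr0 //.
  move=> y /andP[yK ne]; rewrite (tcrdZ hH hJ) ?minreps_KJ // tcrdJ_KT //.
  by rewrite eq_sym (negPf ne) (scaling0r esc).
apply/esym/eqP; rewrite -subr_eq0; apply/eqP.
apply: (bar_fixed_eq0 (hH := hH) (hE := hE) (ht := hJ) hbarH hbarE hbarJ).
  by rewrite (barMD hbarJ) (barMN hbarJ) bz (canonical_bar hCJ) ?minreps_KsJ.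
move=> y d yJ; rewrite raddfB (crdB esc).
have := crd_canonical hH hE hJ hCJ g d (minreps_KsJ wK) yJ.
set cJ := crd _ _ _ => hcJ.
have [yK|[x xK ey]] := minreps_JP yJ.
  rewrite zx // (crdZ esc); apply: uV_AminusB.
    apply: uV_Aminus_uV; rewrite -[crd _ _ _](subrK ((y == w) && (g == d))%:R).
    apply: AminusD; last exact: (Aminus_int ((y == w) && (g == d))).
    by apply/uV_Aminus_sub; apply: (crd_canonical hH hE hK hCK).
  move: hcJ; have -> : (y == w * simple s)%g = false.
    by apply: contraTF yK => /eqP ->; rewrite minreps_KsNK.
  by rewrite subr0.
move: hcJ; rewrite {}/cJ ey (inj_eq (mulIg _)) zs // => hcJ.
rewrite -[X in uV_Aminus X](subrKA ((x == w) && (g == d))%:R).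
apply: uV_AminusD; first exact: (crd_canonical hH hE hK hCK).
by rewrite -opprB; apply: uV_AminusN.
Qed.

(** Over K, T_x C' [x] e becomes T_x [x] C' e, and the components e in question are [2]-eigenvectors
    of C'. *)
Lemma beta_canonical_s w g : w \in minreps K -> s \in L g ->
  beta (CJ (w * simple s)%g g) = scal two (CK w g).
Proof.
move=> wK sg; rewrite canonical_J_s // raddf_sum /=.
rewrite {2}(tcrdE hH hK (CK w g)) (scaling_sumr (scal_scaling MK)).
apply: eq_bigr => x xK; rewrite hbeta -(tensorZr hH hK).
rewrite -(canonical_eigen hH hbarH hE hbarE hK hbarK hCK Cs_central) //.
rewrite /Cprime mulrDr scalerDl (tensorDl hK) (tensorDr hK).
by rewrite (tensor_mulT hK) ?s0_parabolic // (tensor_mull hK) //; apply: hecke_par_scalar.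
Qed.

(** The excluded indices are those of [beta_canonical_s]. The component of the image at x is z_x -
    u^-1 z_xs + C' z_xs; the last term affects only e with s in L(e), and at the other e a leading
    coefficient 1 is cancelled by the subtracted term. *)
Lemma beta_canonical y g : y \in minreps J -> (y \in minreps K) || (s \notin L g) ->
  exists (r : seq (canon_index K Gamma)) (N : canon_index K Gamma -> int),
    beta (CJ y g) - (if (y \in minreps K) && (s \notin L g) then CK y g else 0) =
      \sum_(i <- r) family_on CK i *~ N i /\
    (forall i, s \notin L i.2 -> N i = 0).
Proof.
move=> yJ yg; set z0 := if _ then _ else _.
have z0K x d : x \in minreps K ->
    uV_Aminus (crd eb (tcrdK x z0) d - [&& y \in minreps K, s \notin L g, x == y & g == d]%:R).
  move=> xK; rewrite /z0; case: (boolP (y \in minreps K)) => yK /=; last first.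
    by rewrite raddf0 (crd0 esc) subrr; apply: uV_Aminus0.
  case: (boolP (s \in L g)) => sg /=; last exact: (crd_canonical hH hE hK hCK).
  by rewrite raddf0 (crd0 esc) subrr; apply: uV_Aminus0.
have AP (b : bool) (a : laurent) : uV_Aminus (a - b%:R) -> Aminus a.
  move=> h; rewrite -[a](subrK b%:R); apply: AminusD; last exact: (Aminus_int b).
  exact: uV_Aminus_sub.
have cJ x d : x \in minreps J ->
  uV_Aminus (crd eb (tcrdJ x (CJ y g)) d - ((x == y) && (g == d))%:R).
  by move=> xJ; apply: (crd_canonical hH hE hJ hCJ).
have crdE x d : x \in minreps K -> crd eb (tcrdK x (beta (CJ y g) - z0)) d =
    crd eb (tcrdJ x (CJ y g)) d - crd eb (tcrdK x z0) d
    - uV * crd eb (tcrdJ (x * simple s)%g (CJ y g)) d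
    + crd eb (Cs *: tcrdJ (x * simple s)%g (CJ y g)) d.
  move=> xK; rewrite raddfB tcrd_beta // -[T (simple s)](addrK uV%:A) -/(Cprime T s).
  rewrite scalerBl -/(scal _ _) !(crdB esc) !(crdD esc) (crdN esc) (crdZ esc).
  by rewrite addrAC -!addrA; do 2!congr (_ + _); rewrite addrC.
have [||r [N [eN N0]]] := canonical_expansion (hH := hH) (hE := hE) (ht := hK)
    hbarH hbarE hbarK hCK (z := beta (CJ y g) - z0).
- rewrite (barMD hbarK) (barMN hbarK) barK_beta (canonical_bar hCJ) //; congr (_ - _).
  by rewrite /z0; case: ifP => [/andP[yK _]|_]; rewrite ?(canonical_bar hCK) ?(barM0 hbarK).
- move=> x d xK; rewrite crdE //; apply: AminusD.
    apply: AminusD; last first.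
      by apply/uV_Aminus_sub/uV_AminusN/uV_Aminus_uV; apply: AP (cJ _ _ (minreps_KsJ xK)).
    apply: AminusD; first exact: AP (cJ _ _ (minreps_KJ xK)).
    by rewrite -mulN1r; apply: AminusM; [apply: (Aminus_int (-1)) | apply: AP (z0K _ _ xK)].
  (* The leading 1 would sit at an index (xs, g') with s in L(g') only if y = xs and g = g',
     contrary to [yg]. *)
  apply: crd_Cprime_Aminus => [g'|g' sg']; first exact: AP (cJ _ _ (minreps_KsJ xK)).
  have := cJ _ g' (minreps_KsJ xK); rewrite [_ && _](_ : _ = false) ?subr0 //.
  apply: contraTF yg => /andP[/eqP <- /eqP ->].
  by rewrite negb_or minreps_KsNK // negbK.
exists r, N; split=> // i si; apply: N0; case: i si => -[x xK] d /= sd.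
rewrite crdE // crd_Cprime_out // addr0; apply: uV_AminusB; last first.
  by apply: uV_Aminus_uV; apply: AP (cJ _ _ (minreps_KsJ xK)).
rewrite -[X in uV_Aminus X](subrKA ((x == y) && (g == d))%:R).
apply: uV_AminusD; first exact: cJ (minreps_KJ xK).
rewrite -opprB; apply: uV_AminusN; move: (z0K x d xK).
suff -> : [&& y \in minreps K, s \notin L g, x == y & g == d] = (x == y) && (g == d) by [].
case: eqP => [<-|_]; last by rewrite !andbF.
by case: eqP => [->|_]; rewrite ?xK ?sd ?andbF.
Qed.

End Projection.

(** * Adjoining 1/[2] *)

Section ChangeOfBasis.

Variables (R : nzRingType) (V : zmodType) (sc : R -> V -> V) (I : choiceType).
Hypothesis scP : is_scaling sc.
Implicit Types (b c : I -> V) (A : {fset I}) (f : I -> R).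

Lemma lincomb_widen b A A' f : (A `<=` A')%fset ->
  \sum_(i <- A) sc (f i) (b i) = \sum_(i <- A') sc (if i \in A then f i else 0) (b i).
Proof.
move=> sA; rewrite -[RHS](big_fset_incl _ sA) => [|i _ /negPf ->]; last exact: scaling0l.
by apply: eq_big_seq => i ->.
Qed.

Lemma is_basisP b :
  (forall x, exists A f, x = \sum_(i <- A) sc (f i) (b i)) ->
  (forall A f, \sum_(i <- A) sc (f i) (b i) = 0 -> forall i, i \in A -> f i = 0) ->
  is_basis sc b.
Proof.
move=> span free x; have [A [f ->]] := span x.
pose g : {fsfun I -> R with 0} := [fsfun i in A => f i].
have gE i : g i = if i \in A then f i else 0 by rewrite /g fsfunE.
exists g; split=> [|h].
  have gA : (finsupp g `<=` A)%fset.
    by apply/fsubsetP => i; rewrite mem_finsupp gE; case: ifP => //; rewrite eqxx.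
  rewrite (lincomb_widen _ _ gA); apply: eq_big_seq => i iA; rewrite gE iA; congr (sc _ _).
  by case: ifPn => // /fsfun_dflt; rewrite gE iA.
set A' := (A `|` finsupp h)%fset.
rewrite (lincomb_widen _ _ (fsubsetUl _ _ : (A `<=` A')%fset)).
rewrite (lincomb_widen _ _ (fsubsetUr _ _ : (finsupp h `<=` A')%fset)).
move/eqP; rewrite -subr_eq0 -sumrB => /eqP e.
have {}e : \sum_(i <- A') sc (g i - h i) (b i) = 0.
  rewrite -[RHS]e; apply: eq_bigr => i _; rewrite (scalingDl scP) (scalingNl scP) gE.
  by congr (_ - sc _ _); case: ifPn => // /fsfun_dflt.
apply/fsfunP => i; have [iA|] := boolP (i \in A').
  by apply/eqP; rewrite -subr_eq0 (free _ _ e).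
rewrite in_fsetU negb_or => /andP[/negPf iA /fsfun_dflt ->].
by rewrite gE iA.
Qed.

Lemma is_basis_free b : is_basis sc b ->
  forall A f, \sum_(i <- A) sc (f i) (b i) = 0 -> forall i, i \in A -> f i = 0.
Proof.
move=> bP A f e i iA; have := crd_lincomb scP bP A f i.
by rewrite e (crd0 scP) iA.
Qed.

(* The matrix of z in the basis b has square zero. *)
Lemma is_basis_sub b z (bP : is_basis sc b) :
  (forall i j, crd bP (z i) j != 0 -> z j = 0) -> is_basis sc (fun i => b i - z i).
Proof.
move=> hz; set c := fun i => _.
apply: is_basisP => [|A f e].
  pose P x := exists A f, x = \sum_(i <- A) sc (f i) (c i).
  have P0 : P 0 by exists fset0, (fun=> 0); rewrite big_seq_fset0.
  have PD x y : P x -> P y -> P (x + y).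
    move=> [A [f ->]] [A' [f' ->]]; set B := (A `|` A')%fset.
    exists B, (fun i => (if i \in A then f i else 0) + (if i \in A' then f' i else 0)).
    under [RHS]eq_bigr do rewrite (scalingDl scP); rewrite big_split /=.
    by rewrite -!lincomb_widen ?fsubsetUl ?fsubsetUr.
  have PZ a x : P x -> P (sc a x).
    move=> [A [f ->]]; exists A, (fun i => a * f i); rewrite (scaling_sumr scP).
    by apply: eq_bigr => i _; rewrite (scalingA scP).
  have Pc i : P (c i) by exists [fset i]%fset, (fun=> 1); rewrite big_seq_fset1 (scaling1 scP).
  (* Each [z i] is a combination of [b j] with [z j = 0], and these [b j] equal [c j]. *)
  have Pz i : P (z i).
    rewrite (crdE bP (z i)); elim/big_ind: _ => // j _.
    have [->|/hz zj] := eqVneq (crd bP (z i) j) 0; first by rewrite (scaling0l scP).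
    by apply: PZ; have := Pc j; rewrite /c zj subr0.
  apply: (basis_ind bP) => // a i; apply: PZ.
  by rewrite -[b i](subrK (z i)); apply: (PD _ _ (Pc i) (Pz i)).
have cE j : (if j \in A then f j else 0) = \sum_(i <- A) f i * crd bP (z i) j.
  have := congr1 (fun x => crd bP x j) e.
  under eq_bigr do rewrite (scalingDr scP).
  rewrite big_split (crdD scP) (crd_lincomb scP) (crd0 scP) /= => /eqP.
  rewrite addr_eq0 => /eqP ->; rewrite (crd_sum scP) -sumrN; apply: eq_bigr => i _.
  by rewrite (crdZ scP) (crdN scP) mulrN opprK.
(* If [z i] is nonzero, [hz] makes column i of the matrix of z vanish, so [cE] gives [f i = 0]. *)
have f0 i : i \in A -> z i != 0 -> f i = 0.
  move=> iA zi; have := cE i; rewrite iA => ->; rewrite big1 // => k _.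
  have [->|/hz zi0] := eqVneq (crd bP (z k) i) 0; first by rewrite mulr0.
  by rewrite zi0 eqxx in zi.
move=> j jA; have := cE j; rewrite jA => ->; rewrite big_seq big1 // => i iA.
have [->|zi] := eqVneq (z i) 0; first by rewrite (crd0 scP) mulr0.
by rewrite f0 // mul0r.
Qed.

End ChangeOfBasis.

(** * Bases after inverting [2] *)

Section Localization.

Lemma to_laurent2M a b : to_laurent2 (a * b) = to_laurent2 a * to_laurent2 b.
Proof. exact: val_inj. Qed.

Lemma to_laurent2_int (n : int) : to_laurent2 n%:~R = n%:~R.
Proof.
apply: val_inj; rewrite /= val_int.
exact: esym (rmorph_int (val : {rmorphism laurent2 -> Qu}) n).
Qed.

Fact twoV_subproof : twoQ^-1 \in laurent2_pred.
Proof. by apply/laurent2P; exists 1; rewrite expr1 mulVf ?twoQ_neq0 // rpred1. Qed.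

Definition twoV : laurent2 := Sub twoQ^-1 twoV_subproof.

Lemma mulr_twoV : to_laurent2 two * twoV = 1.
Proof. by apply: val_inj; rewrite /= divff ?twoQ_neq0. Qed.

Lemma to_laurent2_twoX k : to_laurent2 (two ^+ k) * twoV ^+ k = 1.
Proof.
elim: k => [|k IH]; first by apply: val_inj; rewrite /= mulr1.
by rewrite !exprS to_laurent2M mulrACA IH mulr_twoV mulr1.
Qed.

Lemma bar2_twoV (n : int) : bar2 (n%:~R * twoV) = n%:~R * twoV.
Proof.
apply: val_inj; rewrite /= -to_laurent2_int /= val_int.
by rewrite barQM barQ_int barQV barQ_two.
Qed.

Lemma laurent2_clear (f : laurent2) : exists k a, to_laurent2 (two ^+ k) * f = to_laurent2 a.
Proof.
have /laurent2P[k hk] := valP f; exists k, (Sub (val f * twoQ ^+ k) hk).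
apply: val_inj; rewrite /= mulrC; congr (_ * _).
by elim: (k) => // j IH; rewrite !exprS /= IH.
Qed.

Lemma laurent2_clear_seq (I : eqType) (r : seq I) (f : I -> laurent2) :
  exists k (a : I -> laurent), forall i, i \in r -> to_laurent2 (two ^+ k) * f i = to_laurent2 (a i).
Proof.
elim: r => [|i r [k [a IH]]]; first by exists 0, (fun=> 0).
have [k' [a' e']] := laurent2_clear (f i).
exists (k + k')%N, (fun j => if j == i then two ^+ k * a' else two ^+ k' * a j) => j.
rewrite inE exprD; case: eqP => [-> _|_ /= /IH e].
  by rewrite !to_laurent2M -mulrA e'.
by rewrite !to_laurent2M -e [RHS]mulrCA mulrA.
Qed.

Variables (H : algType laurent) (M : lmodType H) (M2 : lmodType laurent2) (io : M -> M2).
Hypothesis hio : is_localization io.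

Lemma io0 : io 0 = 0.
Proof. by apply: (addrI (io 0)); rewrite -(loc_add hio) !addr0. Qed.

Lemma io_sum (J : Type) (r : seq J) (F : J -> M) :
  io (\sum_(j <- r) F j) = \sum_(j <- r) io (F j).
Proof. exact: (big_morph _ (loc_add hio) io0). Qed.

Lemma localized_basis (I : choiceType) (b : I -> M) : is_basis (@scal H M) b ->
  is_basis (fun (a : laurent2) (x : M2) => a *: x) (fun i => io (b i)).
Proof.
move=> bP; have msc := scal_scaling M.
apply: (is_basisP (lmod_scaling M2)) => [y|A f e].
  have [x [k ey]] := loc_surj hio y.
  exists (finsupp (crd bP x)), (fun i => twoV ^+ k * to_laurent2 (crd bP x i)).
  rewrite -[y]scale1r -(to_laurent2_twoX k) mulrC -scalerA ey {1}(crdE bP x) io_sum scaler_sumr.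
  by apply: eq_bigr => i _; rewrite (loc_scal hio) scalerA.
(* A common power of [2] clears the denominators of the relation, and a further power makes it hold
   in M itself, where [b] is free. *)
have [k [a ea]] := laurent2_clear_seq A f.
have : io (\sum_(i <- A) scal (a i) (b i)) = 0.
  rewrite io_sum; transitivity (to_laurent2 (two ^+ k) *: (0 : M2)); last exact: scaler0.
  rewrite -[in RHS]e scaler_sumr.
  by apply: eq_big_seq => i iA; rewrite (loc_scal hio) -ea // scalerA.
move=> /(loc_ker hio)[l]; rewrite (scaling_sumr msc) => e0 i iA.
have {}e0 : \sum_(i <- A) scal (two ^+ l * a i) (b i) = 0.
  by rewrite -[RHS]e0; apply: eq_bigr => j _; rewrite (scalingA msc).
have := is_basis_free msc bP e0 iA.
move=> /(congr1 to_laurent2) /(congr1 ( *%R (twoV ^+ l))).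
rewrite to_laurent2M mulrA [twoV ^+ l * _]mulrC to_laurent2_twoX mul1r -ea // => /(congr1 ( *%R (twoV ^+ k))).
rewrite mulrA [twoV ^+ k * _]mulrC to_laurent2_twoX mul1r => ->.
by rewrite (_ : to_laurent2 0 = 0) ?mulr0 //; apply: val_inj.
Qed.

End Localization.

(** * Assembly of the corrected basis *)

Theorem corollary8p9 (m : nat)
  (* the Hecke algebra of S_n, where n = m + 2 *)
  (H : algType laurent) (T : 'S_m.+2 -> H) (barH : H -> H)
  (hH : is_hecke T) (hbarH : is_hecke_bar T barH)
  (* the W-graph Gamma and the module E = A Gamma *)
  (Gamma : choiceType) (mu : Gamma -> Gamma -> int)
  (L : Gamma -> {set 'I_m.+1}) (E : lmodType H) (v : Gamma -> E)
  (barE : E -> E)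
  (hE : is_Wgraph T mu L v) (hbarE : is_Wgraph_bar v barE)
  (* the tensor products MJ over J'_(n-2) and MK over S \ s_2, with their
     canonical bases *)
  (MJ : lmodType H) (tJ : H -> E -> MJ) (barJ : MJ -> MJ)
  (CJ : 'S_m.+2 -> Gamma -> MJ)
  (hJ : is_tensor T (Jprime m) tJ) (hbarJ : is_tensor_bar barH barE tJ barJ)
  (hCJ : is_canonical_basis T (Jprime m) v tJ barJ CJ)
  (MK : lmodType H) (tK : H -> E -> MK) (barK : MK -> MK)
  (CK : 'S_m.+2 -> Gamma -> MK)
  (hK : is_tensor T (S_minus_s2 m) tK) (hbarK : is_tensor_bar barH barE tK barK)
  (hCK : is_canonical_basis T (S_minus_s2 m) v tK barK CK)
  (* the natural projection *)
  (beta : {linear MJ -> MK}) (hbeta : forall h e, beta (tJ h e) = tK h e)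
  (* adjoining 1/[2] *)
  (MJ2 MK2 : lmodType laurent2) (ioJ : MJ -> MJ2) (ioK : MK -> MK2)
  (hioJ : is_localization ioJ) (hioK : is_localization ioK)
  (barJ2 : MJ2 -> MJ2) (hbarJ2 : is_localized_bar ioJ barJ barJ2)
  (beta2 : {linear MJ2 -> MK2}) (hbeta2 : forall x, beta2 (ioJ x) = ioK (beta x)) :
  exists c : 'S_m.+2 -> Gamma -> MJ2,
    [/\ (* c is a bar-invariant basis *)
        is_basis (fun (a : laurent2) (x : MJ2) => a *: x)
                 (family_on (K := Jprime m) c),
        forall x g, x \in minreps (Jprime m) -> barJ2 (c x g) = c x g,
        (* the transition matrix to the canonical basis tends to 1 *)
        exists P : canon_index (Jprime m) Gamma ->
                   {fsfun canon_index (Jprime m) Gamma -> laurent2 with 0},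
          (forall i, family_on c i =
             \sum_(j <- finsupp (P i)) P i j *: ioJ (family_on CJ j)) /\
          (forall i j, tends_at0 (val (P i j)) (i == j)%:R) &
        (* the images under beta *)
        forall w g, w \in minreps (S_minus_s2 m) ->
          (ord0 \in L g ->
             beta2 (c (w * simple ord0)%g g)
               = to_laurent2 two *: ioK (CK w g) /\
             beta2 (c w g) = 0) /\
          (ord0 \notin L g ->
             beta2 (c (w * simple ord0)%g g) = 0 /\
             beta2 (c w g) = ioK (CK w g))].
Proof.
pose J := Jprime m; pose K := S_minus_s2 m; pose s : 'I_m.+1 := ord0.
have bP := localized_basis hioJ (canonical_basis hCJ).
have sc2 := lmod_scaling MJ2.
(* On W^J these are the indices (ws, g) with w in W^K and s in L(g), where the canonical basis
   element is kept. There ws times s is w, hence the product in [target]. *)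
pose exc (p : 'S_m.+2 * Gamma) := (p.1 \notin minreps K) && (s \in L p.2).
pose target (p : 'S_m.+2 * Gamma) : MK2 :=
  if exc p then to_laurent2 two *: ioK (CK (p.1 * simple s)%g p.2)
  else if (p.1 \in minreps K) && (s \notin L p.2) then ioK (CK p.1 p.2) else 0.
have barJ2D := (loc_bar_semilinear hbarJ2).1; have barJ2Z := (loc_bar_semilinear hbarJ2).2.
have barJ20 : barJ2 0 = 0 by apply: (addrI (barJ2 0)); rewrite -barJ2D !addr0.
(* z is the correction to be subtracted; it is supported on the exceptional indices and vanishes at
   them, as [is_basis_sub] requires. *)
have /choice[z Hz] : forall p : 'S_m.+2 * Gamma, exists z : MJ2, p.1 \in minreps J ->
    [/\ barJ2 z = z, forall j, tends_at0 (val (crd bP z j)) 0,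
        forall j : canon_index J Gamma, crd bP z j != 0 -> exc (val j.1, j.2),
        exc p -> z = 0 & beta2 (ioJ (CJ p.1 p.2) - z) = target p].
  move=> [y g]; have [|yJ] := boolP (y \in minreps J); last by exists 0.
  move=> yJ; have [exy|nexy] := boolP (exc (y, g)).
    exists 0 => _; split=> // [j|j|].
    - by rewrite (crd0 sc2); apply: (tends_at0_int 0).
    - by rewrite (crd0 sc2) eqxx.
    rewrite subr0 hbeta2 /target exy /=; case/andP: exy => /= yK sg.
    have [yK'|[w wK ->]] := minreps_JP yJ; first by rewrite yK' in yK.
    rewrite (beta_canonical_s hH hbarH hE hbarE hJ hbarJ hCJ hK hbarK hCK hbeta) //.
    by rewrite -mulgA simpleK mulg1 (loc_scal hioK).
  have yg : (y \in minreps K) || (s \notin L g) by rewrite -[X in X || _]negbK -negb_and.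
  have [r [N [eN N0]]] :=
    beta_canonical hH hbarH hE hbarE hJ hbarJ hCJ hK hbarK hCK hbeta yJ yg.
  pose CJs (k : canon_index K Gamma) := CJ (val k.1 * simple s)%g k.2.
  pose sh (k : canon_index K Gamma) : canon_index J Gamma :=
    (Sub (val k.1 * simple s)%g (minreps_KsJ (valP k.1)), k.2).
  (* If s is in L(k.2), then [CJs k] maps to [2] times the term of the error indexed by k, hence the
     factor 1/[2]; otherwise [N k] is 0. *)
  pose z := \sum_(k <- r) ((N k)%:~R * twoV) *: ioJ (CJs k).
  have crdz j : crd bP z j = \sum_(k <- r) ((N k)%:~R * twoV) * (sh k == j)%:R.
    rewrite (crd_sum sc2); apply: eq_bigr => k _.
    by rewrite (crdZ sc2) -(crd_basis sc2 bP).
  have zN : barJ2 z = z.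
    rewrite (big_morph _ barJ2D barJ20); apply: eq_bigr => k _.
    by rewrite barJ2Z bar2_twoV (loc_bar hbarJ2) (canonical_bar hCJ) ?minreps_KsJ ?(valP k.1).
  exists z => _; split=> // [j|j zj|].
  - rewrite crdz (big_morph val (id1 := 0) (op1 := +%R)) //.
    apply: tends_at0_sum => k; case: eqP => _; last by rewrite mulr0; apply: (tends_at0_int 0).
    by rewrite mulr1 /= -to_laurent2_int /= val_int; apply: tends_at0_divtwo.
  - apply: contraNT zj => nexj; rewrite crdz big1 // => k _.
    case: eqP => [kj|_]; last by rewrite mulr0.
    rewrite N0 ?mulr0z ?mul0r //; apply: contraNN nexj => sk.
    by rewrite -kj /exc /= minreps_KsNK ?(valP k.1).
  have -> : target (y, g) = ioK (if (y \in minreps K) && (s \notin L g) then CK y g else 0).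
    by rewrite /target (negPf nexy); case: ifP => _; rewrite ?(io0 hioK).
  rewrite raddfB /= hbeta2 -[beta _](subrK (if (y \in minreps K) && (s \notin L g) then CK y g else 0)).
  rewrite (loc_add hioK) eN addrAC (io_sum hioK) raddf_sum /= -sumrB big1 ?add0r // => k _.
  apply/eqP; rewrite subr_eq0; apply/eqP; rewrite linearZ /= hbeta2.
  have [sk|sk] := boolP (s \in L k.2); last by rewrite N0 // !mulr0z mul0r scale0r (io0 hioK).
  rewrite (beta_canonical_s hH hbarH hE hbarE hJ hbarJ hCJ hK hbarK hCK hbeta) ?(valP k.1) //.
  rewrite (loc_scal hioK) scalerA -mulrA [twoV * _]mulrC mulr_twoV mulr1.
  by rewrite -scal_int (loc_scal hioK) to_laurent2_int.
pose c y g := ioJ (CJ y g) - z (y, g).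
have cP : is_basis (fun (a : laurent2) (x : MJ2) => a *: x) (family_on (K := J) c).
  have := is_basis_sub sc2 (z := fun i : canon_index J Gamma => z (val i.1, i.2)) (bP := bP).
  apply=> i j zij; have [_ _ _ exc0 _] := Hz (val j.1, j.2) (valP j.1).
  by have [_ _ /(_ j zij)/exc0] := Hz (val i.1, i.2) (valP i.1).
exists c; split=> //.
- move=> x g xJ; have [bz _ _ _ _] := Hz (x, g) xJ.
  rewrite /c -scaleN1r barJ2D barJ2Z bz (loc_bar hbarJ2) (canonical_bar hCJ) //.
  by congr (_ + _ *: _); apply: val_inj; exact: (barQ_int (-1)).
- exists (fun i => crd bP (family_on c i)); split=> [i|i j]; first exact: crdE.
  have [_ tz _ _ _] := Hz (val i.1, i.2) (valP i.1).
  have -> : crd bP (family_on c i) j = (i == j)%:R - crd bP (z (val i.1, i.2)) j.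
    by rewrite /family_on /c (crdB sc2) -(crd_basis sc2 bP).
  rewrite /= -[(i == j)%:R in X in tends_at0 _ X]subr0; apply: tends_at0D; last exact/tends_at0N/tz.
  by case: eqP => _; [apply: (tends_at0_int 1) | apply: (tends_at0_int 0)].
move=> w g wK; have wsNK := minreps_KsNK wK.
have [_ _ _ _ tw] := Hz (w, g) (minreps_KJ wK).
have [_ _ _ _ tws] := Hz ((w * simple s)%g, g) (minreps_KsJ wK).
split=> sg; split; rewrite /c ?tw ?tws /target /exc /= ?wK ?wsNK ?sg ?(negPf sg) ?(negPf wsNK) //=.
by rewrite -mulgA simpleK mulg1.
Qed.
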